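(* Let $\mathcal{T}$ be the family of Poncelet triangles inscribed in the non-circular ellipse $\mathcal{E}$ and circumscribing the nested ellipse $\mathcal{E}_c$, let $\mathcal{R}$ be the region swept by the circumcircle over $\mathcal{T}$, and let $P$ be a fixed point. If $P$ is on the boundary $\partial\mathcal{R}$, then the locus $\mathcal{L}_{gP}$ of the isogonal conjugate $gP$ of $P$ with respect to the triangles in $\mathcal{T}$ is a parabola.
   Context: $\mathcal{E}$ is a generic ellipse with semiaxes' lengths $a,b$, given by $(x/a)^2+(y/b)^2=1$. $\mathcal{E}_c$ is an ellipse nested in $\mathcal{E}$ such that the pair admits a Poncelet porism of triangles, and $\mathcal{T}$ is the resulting one-parameter family of triangles inscribed in $\mathcal{E}$ with sides tangent to $\mathcal{E}_c$. $\mathcal{R}$ is the region swept by the circumcircles of the triangles in $\mathcal{T}$; its boundary $\partial\mathcal{R}$ is the envelope of the circumcircles. The isogonal conjugate $gP$ of a point $P$ with respect to a triangle is the point of concurrence of the cevians of $P$ (lines from each vertex through $P$) reflected about the angle bisectors; if $P$ has barycentric coordinates $[z_1:z_2:z_3]$ and the triangle has sidelengths $l_1,l_2,l_3$, then $gP=[l_1^2/z_1:l_2^2/z_2:l_3^2/z_3]$. Isogonal conjugation sends a triangle's circumcircle to the line at infinity.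
   Formalization: The claim fails when P on the boundary of R also lies on the ellipse E (e.g. an endpoint of an axis of E when E_c is E scaled by 1/2): the locus is then a straight line. The formal statement concludes a parabola for P off E and a line for P on E. *)

(* Defs.v *)
From HB Require Import structures.
From mathcomp Require Import all_boot all_order all_algebra.
From mathcomp Require Import all_classical all_reals all_analysis.

Set Implicit Arguments.
Unset Strict Implicit.
Unset Printing Implicit Defensive.

Import Order.TTheory GRing.Theory Num.Theory.
Import numFieldNormedType.Exports.
Local Open Scope classical_set_scope.
Local Open Scope ring_scope.

Section Plane.
Variable R : realType.
Implicit Types (A B C D F P Q u v n : R * R) (S L : set (R * R)).

Definition dot u v : R := u.1 * v.1 + u.2 * v.2.
Definition cross u v : R := u.1 * v.2 - u.2 * v.1.

(* `|v| on R * R is the sup norm; lengths must be Euclidean. *)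
Definition enorm v : R := Num.sqrt (dot v v).
Definition dist A B : R := enorm (B - A).

Definition line A B : set (R * R) := [set Q | exists t : R, Q = A + t *: (B - A)].

Definition collinear A B C : Prop := cross (B - A) (C - A) = 0.

(* x^2/a^2 + y^2/b^2 = 1 *)
Definition axis_ellipse (a b : R) : set (R * R) :=
  [set Q | (Q.1 / a) ^+ 2 + (Q.2 / b) ^+ 2 = 1].

(* Arbitrary centre D and semiaxes p, q; the unit vector u directs the axis of
   semilength p. *)
Definition is_ellipse S : Prop :=
  exists D u, exists p q : R, [/\ dot u u = 1, 0 < p, 0 < q &
    S = [set Q | (dot u (Q - D) / p) ^+ 2 + (cross u (Q - D) / q) ^+ 2 = 1]].

Definition nested_in S (a b : R) : Prop :=
  forall Q, S Q -> (Q.1 / a) ^+ 2 + (Q.2 / b) ^+ 2 < 1.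

(* A line is tangent to an ellipse iff it meets it in exactly one point; this
   is only meant for L a line and S an ellipse. *)
Definition tangent L S : Prop := exists! Q, L Q /\ S Q.

(* Membership of the triangle ABC in the Poncelet family. When Ec is nested in
   E, a sideline touches Ec inside the corresponding chord of E, so tangency of
   the sidelines is tangency of the sides. *)
Definition poncelet_triangle (E Ec : set (R * R)) A B C : Prop :=
  [/\ ~ collinear A B C,
      [/\ E A, E B & E C] &
      [/\ tangent (line A B) Ec, tangent (line B C) Ec & tangent (line C A) Ec]].

Definition poncelet_porism (E Ec : set (R * R)) : Prop :=
  forall A, E A -> exists B C, poncelet_triangle E Ec A B C.

Definition circumcircle A B C : set (R * R) :=
  [set Q | exists D, [/\ dist D B = dist D A, dist D C = dist D A &
                         dist D Q = dist D A]].

(* The union of the circumcircles as curves, not as discs. *)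
Definition swept_region (E Ec : set (R * R)) : set (R * R) :=
  [set Q | exists A B C, poncelet_triangle E Ec A B C /\ circumcircle A B C Q].

Definition boundary S : set (R * R) := closure S `\` interior S.

(* Direction of the internal bisector at A of the triangle ABC. *)
Definition bisector_dir A B C : R * R :=
  (enorm (B - A))^-1 *: (B - A) + (enorm (C - A))^-1 *: (C - A).

(* Reflection of the vector v in the linear line spanned by u. *)
Definition reflect u v : R * R := (2 * dot u v / dot u u) *: u - v.

(* The cevian AP reflected about the bisector at A. *)
Definition reflected_cevian A B C P : set (R * R) :=
  line A (A + reflect (bisector_dir A B C) (P - A)).

(* A relation rather than a function: the isogonal conjugate does not exist when
   P is a vertex (a cevian is undefined) nor when P is any other point of the
   circumcircle (the reflected cevians are parallel, i.e. the conjugate is at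
   infinity). In all other cases it exists and is unique. *)
Definition isogonal_conjugate A B C P Q : Prop :=
  [/\ P <> A, P <> B & P <> C] /\
  [/\ reflected_cevian A B C P Q,
      reflected_cevian B C A P Q &
      reflected_cevian C A B P Q].

Definition isogonal_locus (E Ec : set (R * R)) P : set (R * R) :=
  [set Q | exists A B C,
     poncelet_triangle E Ec A B C /\ isogonal_conjugate A B C P Q].

(* The line through D with normal vector n. *)
Definition normal_line D n : set (R * R) := [set Q | dot n (Q - D) = 0].

Definition is_line S : Prop := exists D n, n <> 0 /\ S = normal_line D n.

(* Focus F, directrix normal_line D n. *)
Definition is_parabola S : Prop :=
  exists F D n, [/\ n <> 0, ~ normal_line D n F &
    S = [set Q | dist F Q = `|dot n (Q - D)| / enorm n]].

End Plane.

(* Main.v *)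
Require Import Defs.
From HB Require Import structures.
From mathcomp Require Import all_boot all_order all_algebra.
From mathcomp Require Import all_classical all_reals all_analysis.
From mathcomp Require Import complex ring lra.
Set Implicit Arguments.
Unset Strict Implicit.
Unset Printing Implicit Defensive.
Import Order.TTheory GRing.Theory Num.Theory.
Import numFieldNormedType.Exports.
Local Open Scope classical_set_scope.
Local Open Scope ring_scope.

(** Why the theorem is true.

    Primes denote complex conjugates.  The coordinate x/a + i y/b turns the
    outer ellipse into the unit circle.  The chord with ends z and w becomes
    the line X + z w X' = z + w, and its tangency to the inner ellipse is a
    quadratic condition on (z + w, z w) whose coefficients are given by the
    foci f and g of the image of that ellipse (dual_conic_foci).  The existence
    of one closed triangle forces a relation between f, g and the minor axis
    (cayley), after which the vertices of a triangle satisfy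
    z1 + z2 + z3 = f + g + l (f g)', where l = z1 z2 z3 has modulus 1
    (vertex_sum), and every unit l occurs (triangle_with_product).  The family
    is therefore a circle, with parameter l.

    The power of a fixed point P with respect to the circumcircle is a real
    affine function of l (circum_power, circum_powerP).  So P lies in the swept
    region when the line where this function vanishes meets the unit circle,
    and on its boundary that line is tangent to the unit circle, at one
    parameter l0 (boundary_tangency, tangency); here a <> b makes the power
    depend on l.

    P and Q are isogonal conjugates exactly when they are the foci of a conic
    tangent to the three sides, that is, when the product of their distances to
    a side is the same for all sides (isogonal_conjugateP).  For the unknown Q
    this is a system of real linear equations which reduces to one complex
    equation A d + (l - C) d' = H, where d is Q up to a translation and A, C, H
    depend on P only (isogonal_systemP, isogonal_system_solve).  Its determinant
    is the power of P up to a constant factor, and by Cramer's rule the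
    numerator of d is affine in l.  With l = l0 (T + i) / (T - i) the
    determinant is a constant times 1 / (T^2 + 1), and d is a quadratic
    polynomial in the real number T (locus_param).  Nothing comes from l0
    itself: a point of the circumcircle other than a vertex has no isogonal
    conjugate (concyclic_isogonal_vertex).

    The coefficients of T and T^2 are linearly independent as soon as that of
    T^2 is nonzero (param_independent), and the latter vanishes exactly when P
    is on the outer ellipse (vertex_defect_neq0, vertex_defect_eq0).  Hence the
    locus is a whole parabola when P is off the outer ellipse, and a whole line
    when P is on it: there P is a vertex of the triangle l0. *)

(** * Euclidean plane geometry *)

Lemma dot_gt0 (R : realType) (v : R * R) : v <> 0 -> 0 < dot v v.
Proof.
case: v => x y nz; rewrite /dot /= -!expr2.
have [x0|x0] := eqVneq x 0; last by rewrite ltr_wpDr ?sqr_ge0 // exprn_even_gt0.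
have [y0|y0] := eqVneq y 0; last by rewrite ltr_wpDl ?sqr_ge0 // exprn_even_gt0.
by case: nz; rewrite x0 y0.
Qed.

Lemma parallelP (R : realType) (r q : R * R) : r <> 0 ->
  (exists t : R, q = t *: r) <-> cross r q = 0.
Proof.
move=> nz; have := dot_gt0 nz; case: r q nz => [r1 r2] [q1 q2] _ /=.
rewrite /dot /cross /= => d0; split=> [[t [-> ->]]|e].
  by rewrite /GRing.scale /=; ring.
exists ((q1 * r1 + q2 * r2) / (r1 * r1 + r2 * r2)).
have {}e : r1 * q2 = r2 * q1 by apply/eqP; rewrite -subr_eq0 e.
by congr (_, _); rewrite /GRing.scale /=; field: e; rewrite ?gt_eqF.
Qed.

Lemma crossNv (R : realType) (v : R * R) : cross (- v) v = 0.
Proof. by case: v => x y; rewrite /cross /=; ring. Qed.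

Lemma enorm_ge0 (R : realType) (v : R * R) : 0 <= enorm v.
Proof. exact: sqrtr_ge0. Qed.

Lemma dot_ge0 (R : realType) (v : R * R) : 0 <= dot v v.
Proof. by rewrite /dot -!expr2 addr_ge0 ?sqr_ge0. Qed.

Lemma sqr_enorm (R : realType) (v : R * R) : enorm v ^+ 2 = dot v v.
Proof. by rewrite sqr_sqrtr // dot_ge0. Qed.

Lemma enorm_gt0 (R : realType) (v : R * R) : v <> 0 -> 0 < enorm v.
Proof. by move=> /dot_gt0 d; rewrite sqrtr_gt0. Qed.

(** The imaginary part of p q (b c)' for vectors read as complex numbers; it
    vanishes when p and q are symmetric about a bisector of the angle of b and
    c. *)
Definition isogonal_form (R : realType) (b c p q : R * R) : R :=
  (p.1 * q.2 + p.2 * q.1) * (b.1 * c.1 - b.2 * c.2)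
  - (p.1 * q.1 - p.2 * q.2) * (b.1 * c.2 + b.2 * c.1).

(** Isogonal directions seen through distances: the products of the distances
    from p and from q to the lines spanned by b and by c agree. *)
Lemma isogonal_formE (R : realType) (b c p q : R * R) :
  isogonal_form b c p q * cross b c =
  cross b p * cross b q * dot c c - cross c p * cross c q * dot b b.
Proof. by rewrite /isogonal_form /cross /dot; ring. Qed.

(** As complex numbers, unit vectors b and c satisfy
    (b + c)^2 = |b + c|^2 b c, so the reflection of p in the line of b + c is
    b c p'. *)
Lemma cross_reflect (R : realType) (b c p q : R * R) :
  dot b b = 1 -> dot c c = 1 -> b + c <> 0 ->
  cross (Defs.reflect (b + c) p) q = isogonal_form b c p q.
Proof.
move=> hb hc /dot_gt0 d0; apply: (mulIf (lt0r_neq0 d0)).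
have -> : cross (Defs.reflect (b + c) p) q * dot (b + c) (b + c) =
  2 * dot (b + c) p * cross (b + c) q - dot (b + c) (b + c) * cross p q.
  rewrite /Defs.reflect; move: (dot (b + c) (b + c)) (dot (b + c) p) d0 => s t s0.
  case: (b + c) q p => x y [q1 q2] [p1 p2]; rewrite /cross /= /GRing.scale /=.
  by field; rewrite gt_eqF.
have -> : 2 * dot (b + c) p * cross (b + c) q - dot (b + c) (b + c) * cross p q =
   isogonal_form b c p q * dot (b + c) (b + c)
   + (2 - dot b b - dot c c) * isogonal_form b c p q
   + (1 - dot c c) * isogonal_form b b p q
   + (1 - dot b b) * isogonal_form c c p q.
  case: b c p q {hb hc d0} => b1 b2 [c1 c2] [p1 p2] [q1 q2].
  by rewrite /isogonal_form /dot /cross /=; ring.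
by rewrite hb hc; ring.
Qed.

Lemma reflect_neq0 (R : realType) (d p : R * R) :
  d <> 0 -> p <> 0 -> Defs.reflect d p <> 0.
Proof.
move=> /dot_gt0 d0 /dot_gt0 p0 e.
suff : dot (Defs.reflect d p) (Defs.reflect d p) = dot p p.
  by rewrite e /dot /= !mul0r addr0 => e0; move: p0; rewrite /dot -e0 ltxx.
rewrite /Defs.reflect; move: d0; case: d p {p0 e} => x y [p1 p2];
  rewrite /dot /= /GRing.scale /= => d0.
by field; rewrite gt_eqF.
Qed.

(** The condition P <> A makes the reflected cevian a genuine line, and
    non-collinearity makes the bisector direction nonzero. *)
Lemma reflected_cevianP (R : realType) (A B C P Q : R * R) :
  ~ collinear A B C -> P <> A ->
  reflected_cevian A B C P Q <->
  cross (B - A) (P - A) * cross (B - A) (Q - A) * dot (C - A) (C - A) =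
  cross (C - A) (P - A) * cross (C - A) (Q - A) * dot (B - A) (B - A).
Proof.
rewrite /collinear /reflected_cevian /bisector_dir => nc PA.
move: nc; set b := B - A; set c := C - A => nc.
have p0 : P - A <> 0 by move=> /subr0_eq.
set p := P - A in p0 *.
have b0 : b <> 0 by move=> b0; apply: nc; rewrite b0 /cross /=; ring.
have c0 : c <> 0 by move=> c0; apply: nc; rewrite c0 /cross /=; ring.
have nb := enorm_gt0 b0; have ncc := enorm_gt0 c0.
set b' := _ *: b; set c' := _ *: c.
have hb' : dot b' b' = 1.
  have := sqr_enorm b; rewrite /b' /dot /= /GRing.scale /= expr2 => e.
  by apply: (mulIf (lt0r_neq0 (mulr_gt0 nb nb))); rewrite {2}e mul1r -e; field: e; rewrite gt_eqF.
have hc' : dot c' c' = 1.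
  have := sqr_enorm c; rewrite /c' /dot /= /GRing.scale /= expr2 => e.
  by apply: (mulIf (lt0r_neq0 (mulr_gt0 ncc ncc))); rewrite {2}e mul1r -e; field: e;
    rewrite gt_eqF.
have cb' : cross b' c' = (enorm b)^-1 * (enorm c)^-1 * cross b c.
  by rewrite /b' /c' /cross /= /GRing.scale /=; ring.
have cb'0 : cross b' c' != 0.
  rewrite cb'; apply: mulf_neq0; last exact/eqP.
  by rewrite mulf_neq0 // invr_neq0 // lt0r_neq0.
have d0 : b' + c' <> 0.
  move=> e; have e' : b' = - c' by apply/eqP; rewrite -addr_eq0 e.
  by move: cb'0; rewrite e' crossNv eqxx.
have r0 := reflect_neq0 d0 p0.
have lineE : (line A (A + Defs.reflect (b' + c') p) Q) <-> (exists t : R, (Q - A) = t *: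
  Defs.reflect (b' + c') p).
  rewrite /line /= addrAC subrr add0r; split=> [[t ->]|[t e]]; exists t.
    by rewrite addrAC subrr add0r.
  by rewrite -e addrC subrK.
apply: (iff_trans lineE); apply: (iff_trans (parallelP (Q - A) r0)).
rewrite cross_reflect //.
have -> : isogonal_form b' c' p (Q - A) =
   (enorm b)^-1 * (enorm c)^-1 * isogonal_form b c p (Q - A).
  by rewrite /isogonal_form /b' /c' /= /GRing.scale /=; ring.
have k0 : (enorm b)^-1 * (enorm c)^-1 != 0 by rewrite mulf_neq0 ?invr_neq0 ?lt0r_neq0.
have H := isogonal_formE b c p (Q - A).
split=> [/eqP|] e.
  move: e; rewrite mulf_eq0 (negbTE k0) /= => /eqP e; move: H; rewrite e mul0r => /esym/eqP.
  by rewrite subr_eq0 => /eqP.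
move: H; rewrite e subrr => /eqP; rewrite mulf_eq0 (introF eqP nc) orbF => /eqP ->.
by rewrite mulr0.
Qed.

(** Dividing by dot (Y - X) (Y - X) turns the left-hand side into the product
    of the signed distances from P and Q to the line XY. *)
Definition isogonal_side (R : realType) (P Q : R * R) (K : R) (X Y : R * R) : Prop :=
  cross (Y - X) (P - X) * cross (Y - X) (Q - X) = K * dot (Y - X) (Y - X).

(** The foci of a conic tangent to the sides: their distances to a tangent have
    a constant product.  Each vertex gives the equality of the products for the
    two sides through it, and K is the common value. *)
Lemma isogonal_conjugateP (R : realType) (A B C P Q : R * R) :
  ~ collinear A B C ->
  isogonal_conjugate A B C P Q <->
  [/\ P <> A, P <> B & P <> C] /\
  exists K, [/\ isogonal_side P Q K A B, isogonal_side P Q K B C & isogonal_side P Q K C A].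
Proof.
move=> nc; rewrite /isogonal_conjugate /isogonal_side.
pose f X Y := cross (Y - X) (P - X) * cross (Y - X) (Q - X).
pose g (X Y : R * R) := dot (Y - X) (Y - X).
have fC X Y : f X Y = f Y X.
  by rewrite /f /cross; case: X Y P Q {nc f g} => [? ?] [? ?] [? ?] [? ?] /=; ring.
have gC X Y : g X Y = g Y X.
  by rewrite /g /dot; case: X Y {nc f g fC} => [? ?] [? ?] /=; ring.
have nc1 : ~ collinear B C A.
  move=> e; apply: nc; rewrite /collinear -e /cross; case: A B C {e} => [? ?] [? ?] [? ?] /=;
    ring.
have nc2 : ~ collinear C A B.
  move=> e; apply: nc; rewrite /collinear -e /cross;
    case: A B C {nc1 e} => [? ?] [? ?] [? ?] /=; ring.
have gN0 X Y : X <> Y -> g X Y != 0.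
  by move=> XY; rewrite lt0r_neq0 // dot_gt0 // => /subr0_eq e; apply: XY.
have AB : A <> B by move=> e; apply: nc; rewrite /collinear /cross e /= !subrr !mul0r subrr.
have BC : B <> C by move=> e; apply: nc1; rewrite /collinear /cross e /= !subrr !mul0r subrr.
have CA : C <> A by move=> e; apply: nc2; rewrite /collinear /cross e /= !subrr !mul0r subrr.
have {}AB := gN0 _ _ AB; have {}BC := gN0 _ _ BC; have {}CA := gN0 _ _ CA.
split=> -[[PA PB PC]].
  move=> [/(reflected_cevianP Q nc PA) hA /(reflected_cevianP Q nc1 PB) hB
    /(reflected_cevianP Q nc2 PC) hC]; split=> //.
  have {}hA : f A B * g C A = f C A * g A B by rewrite (fC C A) (gC C A).
  have {}hB : f B C * g A B = f A B * g B C by rewrite (fC A B) (gC A B).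
  exists (f A B / g A B); split.
  - by rewrite -/(g A B) mulfVK.
  - by rewrite -/(f B C) -/(g B C) mulrAC -hB mulfK.
  - by rewrite -/(f C A) -/(g C A) mulrAC hA mulfK.
move=> [K []]; rewrite -/(f A B) -/(f B C) -/(f C A) -/(g A B) -/(g B C) -/(g C A) => hA hB hC.
split=> //; split.
- apply/(reflected_cevianP Q nc PA).
  by rewrite -/(f A B) -/(f A C) -/(g A B) -/(g A C) (fC A C) (gC A C) hA hC; ring.
- apply/(reflected_cevianP Q nc1 PB).
  by rewrite -/(f B C) -/(f B A) -/(g B C) -/(g B A) (fC B A) (gC B A) hA hB; ring.
- apply/(reflected_cevianP Q nc2 PC).
  by rewrite -/(f C A) -/(f C B) -/(g C A) -/(g C B) (fC C B) (gC C B) hC hB; ring.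
Qed.

Lemma circumcircleP (R : realType) (A B C Q : R * R) :
  circumcircle A B C Q <->
  exists D, [/\ dot (B - D) (B - D) = dot (A - D) (A - D),
                dot (C - D) (C - D) = dot (A - D) (A - D) &
                dot (Q - D) (Q - D) = dot (A - D) (A - D)].
Proof.
have E X Y D : dist D X = dist D Y <-> dot (X - D) (X - D) = dot (Y - D) (Y - D) :> R.
  rewrite /dist; split=> e; last by rewrite /enorm e.
  by rewrite -!sqr_enorm e.
by split=> -[D [/E ? /E ? /E ?]]; exists D; split=> //; apply/E.
Qed.

Definition general_ellipse (R : realType) (D u : R * R) (p q : R) : set (R * R) :=
  [set Q | (dot u (Q - D) / p) ^+ 2 + (cross u (Q - D) / q) ^+ 2 = 1].

(** Along the line the equation of the ellipse is quadratic in the parameter,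
    so meeting it once means that the discriminant vanishes. *)
Lemma tangent_general_ellipseP (R : realType) (D u : R * R) (p q : R) (A B : R * R) :
  dot u u = 1 -> 0 < p -> 0 < q -> A <> B ->
  tangent (line A B) (general_ellipse D u p q) <->
  cross (A - D) (B - A) ^+ 2 = q ^+ 2 * dot u (B - A) ^+ 2 + p ^+ 2 * cross u (B - A) ^+ 2.
Proof.
move=> u1 p0 q0 AB.
have v0 : B - A <> 0 by move=> /subr0_eq e; apply: AB.
have vv := dot_gt0 v0.
set v := B - A in v0 vv *.
have pN0 := lt0r_neq0 p0; have qN0 := lt0r_neq0 q0.
pose x := dot u v / p; pose y := cross u v / q.
pose X := dot u (A - D) / p; pose Y := cross u (A - D) / q.
have key t : general_ellipse D u p q (A + t *: v) <->
    (x ^+ 2 + y ^+ 2) * t ^+ 2 + 2 * (x * X + y * Y) * t + (X ^+ 2 + Y ^+ 2 - 1) = 0.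
  rewrite /general_ellipse /=.
  have -> : dot u (A + t *: v - D) / p = X + t * x.
    by rewrite /X /x /dot; case: u A D v {u1 AB v0 vv x y X Y} => [? ?] [? ?] [? ?] [? ?];
      rewrite /= /GRing.scale /=; ring.
  have -> : cross u (A + t *: v - D) / q = Y + t * y.
    by rewrite /Y /y /cross; case: u A D v {u1 AB v0 vv x y X Y} => [? ?] [? ?] [? ?] [? ?];
      rewrite /= /GRing.scale /=; ring.
  have E : (X + t * x) ^+ 2 + (Y + t * y) ^+ 2 =
     (x ^+ 2 + y ^+ 2) * t ^+ 2 + 2 * (x * X + y * Y) * t + (X ^+ 2 + Y ^+ 2 - 1) + 1 by ring.
  by rewrite E; split=> e; lra.
have a0 : 0 < x ^+ 2 + y ^+ 2.
  have uv : dot u v ^+ 2 + cross u v ^+ 2 = dot v v.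
    rewrite -[RHS]mul1r -u1 /dot /cross.
    by case: u v {u1 AB v0 vv x y X Y key} => [? ?] [? ?] /=; ring.
  have [ux|ux] := eqVneq (dot u v) 0.
    rewrite ltr_wpDl ?sqr_ge0 // exprn_even_gt0 //= /y mulf_neq0 ?invr_neq0 //.
    by apply/eqP => e; move: vv; rewrite -uv ux e expr0n /= addr0 ltxx.
  by rewrite ltr_wpDr ?sqr_ge0 // exprn_even_gt0 //= /x mulf_neq0 ?invr_neq0.
have discr : (x * X + y * Y) ^+ 2 = (x ^+ 2 + y ^+ 2) * (X ^+ 2 + Y ^+ 2 - 1) <->
   cross (A - D) v ^+ 2 = q ^+ 2 * dot u v ^+ 2 + p ^+ 2 * cross u v ^+ 2.
  have c : x * Y - y * X = - cross (A - D) v / (p * q).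
    rewrite -[in RHS](mul1r (cross _ _)) -u1 /x /y /X /Y /dot /cross.
    case: u A D v {u1 AB v0 vv x y X Y key a0} => [? ?] [? ?] [? ?] [? ?] /=.
    by field; rewrite pN0 qN0.
  have e1 : (p * q) ^+ 2 * (x * Y - y * X) ^+ 2 = cross (A - D) v ^+ 2.
    by rewrite c; field; rewrite pN0 qN0.
  have e2 : (p * q) ^+ 2 * (x ^+ 2 + y ^+ 2) = q ^+ 2 * dot u v ^+ 2 + p ^+ 2 * cross u v ^+ 2.
    by rewrite /x /y; field; rewrite pN0 qN0.
  rewrite -e1 -e2.
  have pq0 : (p * q) ^+ 2 != 0 by rewrite expf_neq0 // mulf_neq0.
  have L : (x * Y - y * X) ^+ 2 = (x ^+ 2 + y ^+ 2) * (X ^+ 2 + Y ^+ 2) - (x * X +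
    y * Y) ^+ 2 by ring.
  split=> e; first by rewrite L e; ring.
  by move/(mulfI pq0): e; rewrite L => e; lra.
apply: iff_trans discr.
move: key a0; set al := x ^+ 2 + y ^+ 2; set be := x * X + y * Y; set ga := _ - 1 => key a0.
have aN0 := lt0r_neq0 a0.
split=> [[Q [[[t0 Qt] SQ] uniQ]]|e].
  rewrite -/v in Qt; move: (SQ); rewrite Qt => /key E0.
  (* the other root of the quadratic equation *)
  pose t1 := - (2 * be) / al - t0.
  have E1 : al * t1 ^+ 2 + 2 * be * t1 + ga = 0 by rewrite -E0 /t1; field.
  have := uniQ (A + t1 *: v) (conj (ex_intro _ t1 erefl) (proj2 (key t1) E1)).
  rewrite Qt => /addrI /eqP; rewrite -subr_eq0 -scalerBl scaler_eq0 => /orP[|/eqP//].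
  rewrite subr_eq0 /t1 => /eqP t01.
  have bt : be = - al * t0.
    have : 2 * be = - al * (2 * t0) by rewrite [2 * t0](_ : _ = t0 + t0); [rewrite {1}t01;
      field|ring].
    by move=> h; lra.
  have -> : ga = al * t0 ^+ 2 by move: E0; rewrite bt => h; lra.
  by rewrite bt; ring.
have ga_e : ga = be ^+ 2 / al by rewrite e; field.
exists (A + (- be / al) *: v); split.
  by split; [exists (- be / al)|apply/key; rewrite ga_e; field].
move=> Q' [[t ->]] /key E; congr (_ + _ *: _).
have : al * (t + be / al) ^+ 2 = 0 by rewrite -E ga_e; field.
move/eqP; rewrite mulf_eq0 (negbTE aN0) /= expf_eq0 /= addr_eq0 => /eqP ->.
by rewrite mulNr.
Qed.

(** The left-hand side is the square of the support function of the centred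
    inner ellipse in the direction normal to the outer ellipse at (a x, b y).
    Nestedness, applied to the point of the inner ellipse that is extreme in
    this direction, keeps it on the inner side of the tangent there. *)
Lemma nested_support (R : realType) (D u : R * R) (p q a b : R) (x y : R) :
  0 < a -> 0 < b -> dot u u = 1 -> 0 < p -> 0 < q ->
  nested_in (general_ellipse D u p q) a b -> x ^+ 2 + y ^+ 2 = 1 ->
  p ^+ 2 * dot u (x / a, y / b) ^+ 2 + q ^+ 2 * cross u (x / a, y / b) ^+ 2
    < (1 - dot (x / a, y / b) D) ^+ 2.
Proof.
move=> a0 b0 u1 p0 q0 nest xy.
have [aN0 bN0 pN0 qN0] := And4 (lt0r_neq0 a0) (lt0r_neq0 b0) (lt0r_neq0 p0) (lt0r_neq0 q0).
set n := (x / a, y / b).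
have n0 : n <> 0.
  case=> /eqP; rewrite mulf_eq0 invr_eq0 (negbTE aN0) orbF => /eqP x0.
  move/eqP; rewrite mulf_eq0 invr_eq0 (negbTE bN0) orbF => /eqP y0.
  by move: xy; rewrite x0 y0 expr0n /= addr0 => /esym/eqP; rewrite oner_eq0.
have nn := dot_gt0 n0.
set W := _ + _.
have un : dot u n ^+ 2 + cross u n ^+ 2 = dot n n.
  by rewrite -[RHS]mul1r -u1 /dot /cross; case: u n {u1 nest n0 nn W} => [? ?] [? ?] /=; ring.
have W0 : 0 < W.
  rewrite /W; have [ux|ux] := eqVneq (dot u n) 0.
    rewrite ux expr0n /= mulr0 add0r; apply: mulr_gt0; first exact: exprn_gt0.
    rewrite exprn_even_gt0 //=.
    by apply/eqP => e; move: nn; rewrite -un ux e expr0n /= addr0 ltxx.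
  apply: ltr_wpDr; first by rewrite mulr_ge0 ?sqr_ge0.
  by apply: mulr_gt0; [exact: exprn_gt0|rewrite exprn_even_gt0].
(* W is H^2, and the point D + (s, r) in the frame of u is the extreme one *)
pose H := Num.sqrt W.
have H0 : 0 < H by rewrite sqrtr_gt0.
have HN0 := lt0r_neq0 H0.
have HH : H ^+ 2 = W by rewrite sqr_sqrtr // ltW.
rewrite -HH.
pose s := p ^+ 2 * dot u n / H; pose r := q ^+ 2 * cross u n / H.
pose Q := D + (s * u.1 - r * u.2, s * u.2 + r * u.1).
have QS : general_ellipse D u p q Q.
  rewrite /general_ellipse /= /Q addrAC subrr add0r.
  have -> : dot u (s * u.1 - r * u.2, s * u.2 + r * u.1) = s * dot u u by rewrite /dot /=; ring.
  have -> : cross u (s * u.1 - r * u.2, s * u.2 + r * u.1) =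
    r * dot u u by rewrite /dot /cross /=; ring.
  rewrite u1 !mulr1; apply: (mulIf (expf_neq0 2 HN0)); rewrite mul1r {2}HH /W /s /r.
  by field; rewrite ?HN0 ?pN0 ?qN0.
have := nest _ QS.
have nQ : x * (Q.1 / a) + y * (Q.2 / b) = dot n D + H.
  have -> : x * (Q.1 / a) + y * (Q.2 / b) = dot n D + s * dot u n + r * cross u n.
    by rewrite /Q /n /dot /cross; move: (s) (r) => s' r';
      case: D u {u1 nest n W un W0 H H0 HN0 HH s r Q QS n0 nn} => [? ?] [? ?] /=; ring.
  have -> : H = W / H by rewrite -HH; field.
  by rewrite /s /r /W; ring.
move=> Q1; have HD : H < 1 - dot n D.
  rewrite ltrBrDl -nQ; move: (Q.1 / a) (Q.2 / b) Q1 => c d Q1.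
  have h1 := sqr_ge0 (x - c); have h2 := sqr_ge0 (y - d).
  rewrite -(ltr_pM2l (ltr0Sn R 1)) mulr1.
  have -> : 2 * (x * c + y * d) = (x ^+ 2 + y ^+ 2) + (c ^+ 2 + d ^+ 2) - (x - c) ^+ 2 - (y -
    d) ^+ 2 by ring.
  by rewrite xy; lra.
have D0 : 0 < 1 - dot n D := lt_trans H0 HD.
by rewrite ltr_pXn2r // nnegrE ltW.
Qed.

Lemma is_line_param (R : realType) (e0 e1 : R * R) : e1 <> 0 ->
  is_line [set Q | exists T : R, Q = e0 + T *: e1].
Proof.
move=> e10; exists e0, (- e1.2, e1.1); split.
  by move=> [/eqP h1 h2]; apply: e10; move: h1; rewrite oppr_eq0 => /eqP;
    case: e1 h2 => ? ? /= -> ->.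
apply/seteqP; rewrite /normal_line; split=> Q /=.
  move=> [T ->]; rewrite addrAC subrr add0r /dot; case: e1 {e10} => ? ?;
    rewrite /= /GRing.scale /=; ring.
move=> h; have : cross e1 (Q - e0) = 0.
  by rewrite -h /cross /dot /=; ring.
move/(parallelP (Q - e0) e10) => [T e]; exists T; by rewrite -e addrC subrK.
Qed.

(** In the orthogonal frame (w, e) at V the curve is y = x^2, so the focus is at
    distance |w|^2 / (4 |e|) from the vertex V, along e. *)
Lemma is_parabola_orthogonal_param (R : realType) (V w e : R * R) :
  w <> 0 -> e <> 0 -> dot w e = 0 ->
  is_parabola [set Q | exists T : R, Q = V + T *: w + T ^+ 2 *: e].
Proof.
move=> w0 e0 we; have ww := dot_gt0 w0; have ee := dot_gt0 e0.
have wwN := lt0r_neq0 ww; have eeN := lt0r_neq0 ee.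
(* the focal length in units of e *)
pose f := dot w w / (4 * dot e e).
have f0 : 0 < f by rewrite divr_gt0 // mulr_gt0.
exists (V + f *: e), (V - f *: e), e; split=> //.
  rewrite /normal_line /= => h.
  have : 2 * f * dot e e = 0.
    rewrite -[RHS]h /dot; move: (f) => f'; case: V e {w0 e0 we ee eeN f f0 h wwN ww} =>
      [? ?] [? ?].
    by rewrite /= /GRing.scale /=; ring.
  apply/eqP; apply: mulf_neq0 => //; apply: mulf_neq0; first by rewrite pnatr_eq0.
  exact: lt0r_neq0.
have distE Q : dist (V + f *: e) Q = `|dot e (Q - (V - f *: e))| / enorm e <->
   dot (Q - (V + f *: e)) (Q - (V + f *: e)) * dot e e = dot e (Q - (V - f *: e)) ^+ 2.
  have en := enorm_gt0 e0; rewrite /dist -!sqr_enorm -exprMn.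
  split=> [->|/eqP]; first by rewrite divfK ?gt_eqF // real_normK ?num_real.
  rewrite -[_ ^+ 2 in X in _ == X]real_normK ?num_real // eqrXn2 ?mulr_ge0 ?enorm_ge0 //.
  by move=> /eqP <-; rewrite mulfK ?gt_eqF.
have coordE Q x y : Q = V + x *: w + y *: e ->
   (dist (V + f *: e) Q = `|dot e (Q - (V - f *: e))| / enorm e <-> y = x ^+ 2).
  move=> ->; apply: (iff_trans (distE _)).
  have -> : dot e (V + x *: w + y *: e - (V - f *: e)) = x * dot w e + (y + f) * dot e e.
    rewrite /dot; move: (f) => f'; case: V w e {w0 e0 we ee eeN f f0 distE wwN ww} =>
      [? ?] [? ?] [? ?].
    by rewrite /= /GRing.scale /=; ring.
  have -> : dot (V + x *: w + y *: e - (V + f *: e)) (V + x *: w + y *: e - (V + f *: e)) =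
      x ^+ 2 * dot w w + 2 * x * (y - f) * dot w e + (y - f) ^+ 2 * dot e e.
    rewrite /dot; move: (f) => f'; case: V w e {w0 e0 we ee eeN f f0 distE wwN ww} =>
      [? ?] [? ?] [? ?].
    by rewrite /= /GRing.scale /=; ring.
  rewrite we !mulr0 add0r addr0.
  have E : (x ^+ 2 * dot w w + (y - f) ^+ 2 * dot e e) * dot e e - ((y + f) * dot e e) ^+ 2 =
      (x ^+ 2 - y) * (dot w w * dot e e).
    by rewrite /f; field.
  split=> [h|yE].
    move: E; rewrite h subrr => /esym/eqP; rewrite !mulf_eq0 (negbTE wwN) (negbTE eeN) !orbF.
    by rewrite subr_eq0 => /eqP.
  by apply/eqP; rewrite -subr_eq0 E yE subrr mul0r.
apply/seteqP; split=> Q /=.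
  by move=> [T QE]; apply/(coordE _ _ _ QE).
set v := Q - V.
have QE : Q = V + (dot w v / dot w w) *: w + (dot e v / dot e e) *: e.
  suff : v = (dot w v / dot w w) *: w + (dot e v / dot e e) *: e.
    by rewrite -addrA => <-; rewrite /v addrC subrK.
  have ce : cross w e ^+ 2 = dot w w * dot e e.
    have : cross w e ^+ 2 + dot w e ^+ 2 = dot w w * dot e e.
      by rewrite /cross /dot; ring.
    by rewrite we expr0n /= addr0.
  have cN : cross w e != 0 by rewrite -sqrf_eq0 ce mulf_neq0.
  have el : forall z : R * R, dot w z = 0 -> dot e z = 0 -> z = 0.
    move=> [z1 z2] h1 h2; congr (_, _); apply: (mulIf cN); rewrite mul0r.
      by transitivity (e.2 * dot w (z1, z2) - w.2 * dot e (z1, z2));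
        [rewrite /cross /dot /=; ring|rewrite h1 h2; ring].
    by transitivity (w.1 * dot e (z1, z2) - e.1 * dot w (z1, z2));
      [rewrite /cross /dot /=; ring|rewrite h1 h2; ring].
  have lin (n : R * R) s t : dot n (v - (s *: w + t *: e)) = dot n v - s * dot n w - t * dot n e.
    rewrite /dot; case: v n w e {w0 e0 we ww ee wwN eeN f f0 distE coordE ce cN el} =>
      [? ?] [? ?] [? ?] [? ?].
    by rewrite /= /GRing.scale /=; ring.
  have ew : dot e w = 0 by rewrite -we /dot; ring.
  apply/subr0_eq/el; rewrite lin.
    by rewrite we mulr0 subr0 divfK // subrr.
  by rewrite ew mulr0 subr0 divfK // subrr.
by move/(coordE _ _ _ QE) => h; exists (dot w v / dot w w); rewrite -h.
Qed.

(** A shift of T moves the origin to the vertex, where the velocity is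
    orthogonal to the axis e2. *)
Lemma is_parabola_param (R : realType) (e0 e1 e2 : R * R) : cross e1 e2 != 0 ->
  is_parabola [set Q | exists T : R, Q = e0 + T *: e1 + T ^+ 2 *: e2].
Proof.
move=> c0.
have e20 : e2 <> 0 by move=> e; move: c0; rewrite e /cross /= !mulr0 subrr eqxx.
have ee := lt0r_neq0 (dot_gt0 e20).
(* the parameter of the vertex *)
pose h := - dot e1 e2 / (2 * dot e2 e2).
pose w := e1 + (2 * h) *: e2.
have cw : cross w e2 = cross e1 e2.
  by rewrite /w /cross; move: (h) => h'; case: e1 e2 {c0 e20 ee h w} => [? ?] [? ?];
    rewrite /= /GRing.scale /=; ring.
have w0 : w <> 0 by move=> e; move: c0; rewrite -cw e /cross /= !mul0r subrr eqxx.
have we : dot w e2 = 0.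
  have -> : dot w e2 = dot e1 e2 + 2 * h * dot e2 e2.
    by rewrite /w /dot; move: (h) => h'; case: e1 e2 {c0 e20 ee h w cw w0} => [? ?] [? ?];
      rewrite /= /GRing.scale /=; ring.
  by rewrite /h; field.
have -> : [set Q | exists T : R, Q = e0 + T *: e1 + T ^+ 2 *: e2] =
   [set Q | exists T : R, Q = (e0 + h *: e1 + h ^+ 2 *: e2) + T *: w + T ^+ 2 *: e2].
  apply/seteqP; split=> Q /= [T ->]; [exists (T - h)|exists (T + h)]; rewrite /w; move: (h) => h';
    case: e0 e1 e2 {c0 e20 ee h w cw w0 we} => [? ?] [? ?] [? ?]; congr (_, _);
      rewrite /= /GRing.scale /=; ring.
exact: is_parabola_orthogonal_param.
Qed.

(** * The outer ellipse as the unit circle *)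

Local Open Scope complex_scope.
Local Notation "z ^*" := (conjc z) : ring_scope.
Local Notation "''i'" := (Complex 0 1) : ring_scope.

Lemma conjcD (R : realType) (x y : R[i]) : (x + y)^* = x^* + y^*.
Proof. exact: (rmorphD conjc). Qed.

Lemma conjcB (R : realType) (x y : R[i]) : (x - y)^* = x^* - y^*.
Proof. exact: (rmorphB conjc). Qed.

Lemma conjcM (R : realType) (x y : R[i]) : (x * y)^* = x^* * y^*.
Proof. exact: (rmorphM conjc). Qed.

Lemma conjcX (R : realType) (x : R[i]) n : (x ^+ n)^* = x^* ^+ n.
Proof. exact: (rmorphXn conjc). Qed.

Lemma conjcN (R : realType) (x : R[i]) : (- x)^* = - x^*.
Proof. exact: (rmorphN conjc). Qed.

Definition conjcE (R : realType) :=
  (@conjcB R, @conjcD R, @conjcN R, @conjcM R, @conjcX R, @conjc_inv R, @conjcK R, @conjc0 R,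
   @conjc1 R, fun n => @conjc_nat R n).

(** The outer ellipse corresponds to the unit circle, and the Euclidean vector
    of coordinate z is u z + v z', where u and v are the half sum and the half
    difference of a and b. *)
Definition ecoord (R : realType) (a b : R) (P : R * R) : R[i] := (P.1 / a) +i* (P.2 / b).

Arguments ecoord : simpl never.

Definition epoint (R : realType) (a b : R) (z : R[i]) : R * R :=
  (a * complex.Re z, b * complex.Im z).

Ltac complex_field :=
  apply/eqP; rewrite eq_complex /=; apply/andP; split; apply/eqP; field.

Section Ecoord.
Variables (R : realType) (a b : R).
Hypotheses (a_gt0 : 0 < a) (b_gt0 : 0 < b).
Local Notation ec := (ecoord a b).
Local Notation u := (((a + b) / 2)%:C).
Local Notation v := (((a - b) / 2)%:C).

Let aN0 : a != 0. Proof. exact: lt0r_neq0. Qed.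
Let bN0 : b != 0. Proof. exact: lt0r_neq0. Qed.

Lemma ecoordK P : epoint a b (ec P) = P.
Proof. by case: P => x y; rewrite /epoint /ecoord /=; congr (_, _); field. Qed.

Lemma epointK z : ec (epoint a b z) = z.
Proof. by case: z => x y; rewrite /epoint /ecoord /=; congr (_ +i* _); field. Qed.

Lemma ecoord_inj : injective ec.
Proof. exact: can_inj ecoordK. Qed.

Lemma axis_ellipseP P : axis_ellipse a b P <-> ec P * (ec P)^* = 1.
Proof.
rewrite /axis_ellipse /ecoord /=; move: (P.1 / a) (P.2 / b) => x y.
have -> : (x +i* y) * (x -i* y) = (x ^+ 2 + y ^+ 2)%:C.
  by apply/eqP; rewrite eq_complex /=; apply/andP; split; apply/eqP; ring.
by split=> [->//|[]].
Qed.

Lemma cross_ecoord A B P :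
  2 * 'i * (cross (B - A) (P - A))%:C =
  (a * b)%:C * ((ec B - ec A)^* * (ec P - ec A) - (ec B - ec A) * (ec P - ec A)^*).
Proof.
case: A B P => [a1 a2] [b1 b2] [p1 p2]; rewrite /cross /ecoord /=; complex_field;
  by rewrite aN0 bN0.
Qed.

Lemma dot_ecoord (A B : R * R) :
  (dot (B - A) (B - A))%:C =
  (u * (ec B - ec A) + v * (ec B - ec A)^*) * (u * (ec B - ec A)^* + v * (ec B - ec A)).
Proof.
case: A B => [a1 a2] [b1 b2]; rewrite /dot /ecoord /=; complex_field; by rewrite aN0 bN0.
Qed.

End Ecoord.

Lemma unit_conj (R : realType) (z : R[i]) : z * z^* = 1 -> z^* = z^-1.
Proof.
move=> h; have z0 : z != 0 by apply/eqP => e; move: h; rewrite e mul0r => /esym/eqP;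
  rewrite oner_eq0.
by apply: (mulfI z0); rewrite h divff.
Qed.

Lemma unit_neq0 (R : realType) (z : R[i]) : z * z^* = 1 -> z != 0.
Proof. by move=> h; apply/eqP => e; move: h; rewrite e mul0r => /esym/eqP; rewrite oner_eq0. Qed.

Section Chords.
Variables (R : realType) (a b : R).
Hypotheses (a_gt0 : 0 < a) (b_gt0 : 0 < b).
Local Notation ec := (ecoord a b).
Local Notation u := (((a + b) / 2)%:C).
Local Notation v := (((a - b) / 2)%:C).

Let abN0 : (a * b)%:C != 0 :> R[i].
Proof. by rewrite -(rmorph0 (real_complex R)) (inj_eq (@complexI R)) lt0r_neq0 // mulr_gt0. Qed.

Let iN0 : 2 * 'i != 0 :> R[i].
Proof.
rewrite mulf_neq0 ?pnatr_eq0 //; apply/eqP => -[/eqP]; by rewrite oner_eq0.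
Qed.

Let i2 : (2 * 'i) ^+ 2 = - 4 :> R[i].
Proof. by rewrite exprMn sqr_i; ring. Qed.

(** The line through points of coordinates z and w on the unit circle has
    equation X + z w X' = z + w. *)
Lemma cross_chord A B P : ec A * (ec A)^* = 1 -> ec B * (ec B)^* = 1 ->
  2 * 'i * (cross (B - A) (P - A))%:C =
  - (a * b)%:C * (ec B - ec A) / (ec A * ec B) *
     (ec P + ec A * ec B * (ec P)^* - (ec A + ec B)).
Proof.
move=> hA hB; rewrite (cross_ecoord a_gt0 b_gt0) !conjcB (unit_conj hA) (unit_conj hB).
by have [? ?] := (unit_neq0 hA, unit_neq0 hB); field; apply/andP.
Qed.

Lemma dot_chord A B : ec A * (ec A)^* = 1 -> ec B * (ec B)^* = 1 ->
  (dot (B - A) (B - A))%:C =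
  - (ec B - ec A) ^+ 2 / (ec A * ec B) ^+ 2 *
   ((u - ec A * ec B * v) * (ec A * ec B * u - v)).
Proof.
move=> hA hB; rewrite (dot_ecoord a_gt0 b_gt0) !conjcB (unit_conj hA) (unit_conj hB).
by have [? ?] := (unit_neq0 hA, unit_neq0 hB); field; apply/andP.
Qed.

Lemma chord_coef_neq0 A B : ec A * (ec A)^* = 1 -> ec B * (ec B)^* = 1 -> A <> B ->
  (ec B - ec A) ^+ 2 / (ec A * ec B) ^+ 2 != 0.
Proof.
move=> hA hB AB.
have [? ?] := (unit_neq0 hA, unit_neq0 hB).
rewrite mulf_neq0 ?invr_neq0 ?expf_neq0 ?mulf_neq0 // subr_eq0.
by apply/eqP => /(ecoord_inj a_gt0 b_gt0) e; apply: AB.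
Qed.

Lemma isogonal_side_chord A B P Q K : A <> B ->
  ec A * (ec A)^* = 1 -> ec B * (ec B)^* = 1 ->
  isogonal_side P Q K A B <->
  (ec P + ec A * ec B * (ec P)^* - (ec A + ec B)) *
  (ec Q + ec A * ec B * (ec Q)^* - (ec A + ec B)) =
  (4 * K / (a * b) ^+ 2)%:C * ((u - ec A * ec B * v) * (ec A * ec B * u - v)).
Proof.
move=> AB hA hB; have k0 := chord_coef_neq0 hA hB AB.
have ab0 := abN0.
rewrite /isogonal_side; set X := _ - _ in k0 |- *.
have cP := cross_chord P hA hB; have cQ := cross_chord Q hA hB; have d := dot_chord hA hB.
set XP := ec P + _ - _ in cP *; set XQ := ec Q + _ - _ in cQ *; set L := (_ - _) * (_ - _) in d *.
set k := _ / _ in k0 d.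
have E : (- 4 * (cross (B - A) (P - A) * cross (B - A) (Q - A) - K * dot (B - A) (B - A)))%:C =
   (a * b)%:C ^+ 2 * k * (XP * XQ - (4 * K / (a * b) ^+ 2)%:C * L).
  rewrite rmorphM rmorphN rmorph_nat rmorphB !rmorphM /= -i2.
  have -> : forall x y w : R[i], (2 * 'i) ^+ 2 * (x * y - w) = (2 * 'i * x) * (2 * 'i * y) -
    (2 * 'i) ^+ 2 * w.
    by move=> x y w; ring.
  rewrite cP cQ d i2 /k.
  have -> : ((a * b) ^- 2)%:C = (a%:C * b%:C) ^- 2 :> R[i] by rewrite fmorphV rmorphXn /= rmorphM.
  rewrite rmorphM /= rmorph_nat.
  have [? ?] := (unit_neq0 hA, unit_neq0 hB).
  rewrite /X.
  have [aC bC] : a%:C != 0 :> R[i] /\ b%:C != 0 :> R[i].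
    by move: ab0; rewrite rmorphM /= mulf_eq0 negb_or => /andP.
  by field; apply/and4P.
split=> [/eqP|] e.
  move/eqP: e => e; move: E; rewrite e subrr mulr0 rmorph0 => /esym/eqP.
  have E0 : (a * b)%:C ^+ 2 * k != 0 by rewrite mulf_neq0 // expf_neq0.
  by rewrite mulf_eq0 (negbTE E0) /= subr_eq0 => /eqP.
move: E; rewrite e subrr mulr0 -(rmorph0 (real_complex R)) => /complexI/eqP.
by rewrite mulf_eq0 oppr_eq0 pnatr_eq0 /= subr_eq0 => /eqP.
Qed.

Lemma collinear_chord A B C :
  ec A * (ec A)^* = 1 -> ec B * (ec B)^* = 1 -> ec C * (ec C)^* = 1 ->
  ~ collinear A B C <-> [/\ ec A != ec B, ec B != ec C & ec C != ec A].
Proof.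
move=> hA hB hC; have c := cross_chord C hA hB; have i0 := iN0; have ab0 := abN0.
have [? ? ?] := And3 (unit_neq0 hA) (unit_neq0 hB) (unit_neq0 hC).
have E : 2 * 'i * (cross (B - A) (C - A))%:C =
   - (a * b)%:C / (ec A * ec B * ec C) * ((ec B - ec A) * (ec C - ec B) * (ec C - ec A)).
  by rewrite c (unit_conj hC); field; apply/and3P.
have k0 : - (a * b)%:C / (ec A * ec B * ec C) != 0.
  by rewrite mulf_neq0 ?invr_neq0 ?mulf_neq0 ?oppr_eq0.
rewrite /collinear; split=> [nc|[h1 h2 h3] e].
  have : (ec B - ec A) * (ec C - ec B) * (ec C - ec A) != 0.
    apply/eqP => e; apply: nc; apply: (@complexI R); apply: (mulfI i0).
    by rewrite E e rmorph0 !mulr0.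
  by rewrite !mulf_eq0 !subr_eq0 !negb_or => /andP[/andP[h1 h2] ->]; rewrite eq_sym h1 eq_sym h2.
move: E; rewrite e rmorph0 mulr0 => /esym/eqP; rewrite mulf_eq0 (negbTE k0) /=.
by rewrite !mulf_eq0 !subr_eq0 eq_sym (negbTE h1) eq_sym (negbTE h2) (negbTE h3).
Qed.

(** The dual equation of a conic with foci f and g: for the line
    X + p X' = s with p of modulus 1, the product of the distances from f and g
    is that of f + p f' - s and g + p g' - s, divided by 4 p. *)
Definition tangent_chord (f g K z w : R[i]) : Prop :=
  (f + z * w * f^* - (z + w)) * (g + z * w * g^* - (z + w)) = K * (z * w).

(** In the coordinate ecoord the inner ellipse has centre e and dual equation
    (e + p e' - s)^2 = 4 t p + 2 tau + 2 tau' p^2 with t real; a square root r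
    of 2 tau gives the foci e + r and e - r.  The ellipse is non-degenerate, so
    |tau| < t, which is the positivity of K.  The last clause says that the
    tangent to the unit circle at z, which is the chord with both ends at z,
    passes outside the inner ellipse. *)
Lemma dual_conic_foci (Ec : set (R * R)) : is_ellipse Ec -> nested_in Ec a b ->
  exists f g K : R[i],
  [/\ 0 < K,
      forall A B, axis_ellipse a b A -> axis_ellipse a b B -> A <> B ->
        tangent (line A B) Ec <-> tangent_chord f g K (ec A) (ec B) &
      forall z : R[i], z * z^* = 1 ->
        0 < (2 - f * z^* - f^* * z) * (2 - g * z^* - g^* * z) - K].
Proof.
move=> [D [d [p [q [d1 p0 q0 ->]]]]]; rewrite -/(general_ellipse D d p q) => nest.
have [aN0 bN0] := (lt0r_neq0 a_gt0, lt0r_neq0 b_gt0).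
have ab0 := abN0.
(* al, be, ga: the quadratic form q^2 (u . V)^2 + p^2 (u x V)^2 of
   tangent_general_ellipseP in normalised coordinates, divided by (a b)^2; then
   t and tau are its coefficients in terms of z z', z^2 and z'^2 *)
pose al := (q ^+ 2 * d.1 ^+ 2 + p ^+ 2 * d.2 ^+ 2) / b ^+ 2.
pose be := (q ^+ 2 - p ^+ 2) * d.1 * d.2 / (a * b).
pose ga := (q ^+ 2 * d.2 ^+ 2 + p ^+ 2 * d.1 ^+ 2) / a ^+ 2.
pose t := (al + ga) / 2.
pose tau : R[i] := (- ((al - ga) / 2)) +i* (- be).
pose r := sqrtc (2 * tau).
have r2 : r ^+ 2 = 2 * tau := sqr_sqrtc _.
pose e := ec D.
pose K : R[i] := 4 * t%:C - 2 * (r * r^*).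
have r2c : r^* ^+ 2 = 2 * tau^* by rewrite -conjcX r2 conjcM conjc_nat.
have dets : (al - ga) ^+ 2 / 4 + be ^+ 2 < t ^+ 2.
  have -> : t ^+ 2 = (al - ga) ^+ 2 / 4 + be ^+ 2 + (p * q / (a * b)) ^+ 2 * dot d d ^+ 2.
    by rewrite /t /al /be /ga /dot; case: d {d1 al be ga t tau r r2 K r2c nest} => [? ?] /=;
      field; rewrite aN0 bN0.
  rewrite d1 expr1n mulr1 ltrDl exprn_gt0 // divr_gt0 // mulr_gt0 //.
have t0 : 0 <= t.
  rewrite /t divr_ge0 // addr_ge0 // divr_ge0 ?sqr_ge0 // addr_ge0 // mulr_ge0 ?sqr_ge0 //.
exists (e + r), (e - r), K; split.
- have rr0 : 0 <= r * r^* := mulcJ_ge0 r.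
  have tt : tau * tau^* = ((al - ga) ^+ 2 / 4 + be ^+ 2)%:C.
    by rewrite /tau; complex_field.
  have rr4 : (r * r^*) ^+ 2 < (2 * t%:C) ^+ 2.
    have -> : (r * r^*) ^+ 2 = 4 * (tau * tau^*) by rewrite exprMn r2 r2c; ring.
    have -> : (2 * t%:C) ^+ 2 = 4 * (t ^+ 2)%:C :> R[i] by ring.
    by rewrite tt ltr_pM2l ?ltr0n // ltcR.
  have t2 : 0 <= 2 * t%:C :> R[i] by rewrite mulr_ge0 // ler0c.
  rewrite /K subr_gt0 (_ : 4 * t%:C = 2 * (2 * t%:C)); last by ring.
  rewrite ltr_pM2l ?ltr0n //.
  by rewrite -(@ltr_pXn2r _ 2) // nnegrE.
- move=> A B /axis_ellipseP hA /axis_ellipseP hB AB.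
  apply: (iff_trans (tangent_general_ellipseP D d1 p0 q0 AB)).
  have k0 := chord_coef_neq0 hA hB AB.
  have cD := cross_chord D hA hB.
  have [zA zB] := (unit_neq0 hA, unit_neq0 hB).
  have crossE : cross (A - D) (B - A) = cross (B - A) (D - A).
    by case: A B D {nest e AB hA hB k0 cD zA zB} => [? ?] [? ?] [? ?]; rewrite /cross /=; ring.
  set om := ec B - ec A in k0 cD.
  have formE : (q ^+ 2 * dot d (B - A) ^+ 2 + p ^+ 2 * cross d (B - A) ^+ 2)%:C =
     (a * b)%:C ^+ 2 * (t%:C * (om * om^*) - (tau^* * om ^+ 2 + tau * om^* ^+ 2) / 2).
    rewrite /om /ecoord /tau /t /al /be /ga /dot /cross.
    case: A B d {d1 al be ga t tau r r2 K r2c nest dets t0 AB hA hB k0 cD zA zB crossE om} =>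
      [? ?] [? ?] [? ?] /=.
    by complex_field; rewrite aN0 bN0.
  have omc : om^* = - om / (ec A * ec B).
    by rewrite /om conjcB (unit_conj hA) (unit_conj hB); field; apply/andP.
  rewrite /tangent_chord; set P := ec A * ec B; set S := ec A + ec B.
  have E : (- 4 * (cross (A - D) (B - A) ^+ 2 -
        (q ^+ 2 * dot d (B - A) ^+ 2 + p ^+ 2 * cross d (B - A) ^+ 2)))%:C =
    (a * b)%:C ^+ 2 * (om ^+ 2 / P ^+ 2) *
     ((e + r + P * (e + r)^* - S) * (e - r + P * (e - r)^* - S) - K * P).
    have -> : forall x w : R, (- 4 * (x ^+ 2 - w))%:C = - 4 * (x%:C ^+ 2 - w%:C) :> R[i].
      by move=> x w; ring.
    rewrite formE crossE.
    have -> : forall x w : R[i], - 4 * (x ^+ 2 - w) = (2 * 'i * x) ^+ 2 + 4 * w.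
      by move=> x w; rewrite [(2 * 'i * x) ^+ 2]exprMn i2; ring.
    rewrite cD -/P -/S -/e omc conjcD conjcB.
    have -> : (e + r + P * (e^* + r^*) - S) * (e - r + P * (e^* - r^*) - S) - K * P =
       (e + P * e^* - S) ^+ 2 - r ^+ 2 - P ^+ 2 * r^* ^+ 2 - 4 * t%:C * P.
      by rewrite /K; ring.
    rewrite r2 r2c /P; field; exact/andP.
  have E0 : (a * b)%:C ^+ 2 * (om ^+ 2 / P ^+ 2) != 0.
    by rewrite mulf_neq0 // expf_neq0.
  split=> h.
    move: E; rewrite h subrr mulr0 rmorph0 => /esym/eqP; rewrite mulf_eq0 (negbTE E0) /= subr_eq0.
    by move/eqP.
  move: E; rewrite h subrr mulr0 -(rmorph0 (real_complex R)) => /complexI/eqP.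
  by rewrite mulf_eq0 oppr_eq0 pnatr_eq0 /= subr_eq0 => /eqP.
- move=> z hz.
  have zz : complex.Re z ^+ 2 + complex.Im z ^+ 2 = 1.
    by case: z hz => x y [h1 h2] /=; move: h1; rewrite mulrN opprK -!expr2.
  have := nested_support a_gt0 b_gt0 d1 p0 q0 nest zz; rewrite -subr_gt0 => sup.
  have -> : (2 - (e + r) * z^* - (e + r)^* * z) * (2 - (e - r) * z^* - (e - r)^* * z) - K =
     (2 - e * z^* - e^* * z) ^+ 2 - (r ^+ 2 * z^* ^+ 2 + r^* ^+ 2 * z ^+ 2 + 4 * t%:C)
      - 2 * (r * r^*) * (z * z^* - 1).
    by rewrite /K conjcD conjcB; ring.
  rewrite hz subrr mulr0 subr0 r2 r2c.
  suff -> : (2 - e * z^* - e^* * z) ^+ 2 - (2 * tau * z^* ^+ 2 + 2 * tau^* * z ^+ 2 + 4 * t%:C) =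
    (4 * ((1 - dot (complex.Re z / a, complex.Im z / b) D) ^+ 2 -
     (p ^+ 2 * dot d (complex.Re z / a, complex.Im z / b) ^+ 2 +
       q ^+ 2 * cross d (complex.Re z / a, complex.Im z / b) ^+ 2)))%:C.
    by rewrite (_ : 0 = 0%:C :> R[i]) // ltcR mulr_gt0.
  have -> : t%:C = t%:C * (complex.Re z ^+ 2 + complex.Im z ^+ 2)%:C by rewrite zz rmorph1 mulr1.
  rewrite /e /ecoord /tau /t /al /be /ga /dot /cross.
  case: z D d {hz zz sup d1 nest al be ga t tau r r2 e K r2c dets t0} => [? ?] [? ?] [? ?] /=.
  by complex_field; rewrite aN0 bN0.
Qed.

End Chords.

(** * The Poncelet family as a circle of triangles *)

Definition chord_triangle (R : realType) (f g K z1 z2 z3 : R[i]) : Prop :=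
  [/\ [/\ z1 * z1^* = 1, z2 * z2^* = 1 & z3 * z3^* = 1],
      [/\ z1 != z2, z2 != z3 & z3 != z1] &
      [/\ tangent_chord f g K z1 z2, tangent_chord f g K z2 z3 &
          tangent_chord f g K z3 z1]].

(** If |f| >= 1, some unit z satisfies f z' + f' z = 2, and there the bound
    reads 0 < - K. *)
Lemma focus_in_disk (R : realType) (f g K : R[i]) : 0 < K ->
  (forall z : R[i], z * z^* = 1 ->
        0 < (2 - f * z^* - f^* * z) * (2 - g * z^* - g^* * z) - K) ->
  f * f^* < 1.
Proof.
move=> K0 out; have ff := mulcJ_ge0 f.
have [//|f1] := real_ltP (ger0_real ff) (real1 _).
have fN0 : f != 0 by apply/eqP => e; move: f1; rewrite e mul0r ler10.
have fcN0 : f^* != 0 by rewrite conjc_eq0.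
have [x fx] : exists x : R, f * f^* = x%:C by apply/complex_realP; exact: ger0_real.
have x1 : 1 <= x by rewrite -lecR -fx rmorph1.
pose y := Num.sqrt (x - 1).
have yy : y ^+ 2 = x - 1 by rewrite sqr_sqrtr // subr_ge0.
(* f^* z = 1 + i y has real part 1, and |z| = 1 by the choice of y *)
pose z := (1 +i* y) / f^*.
have zc : z^* = (1 -i* y) / f by rewrite /z conjcM conjc_inv conjcK.
have zz : z * z^* = 1.
  have e : (1 +i* y) * (1 -i* y) = f * f^*.
    by rewrite fx; apply/eqP; rewrite eq_complex /=; apply/andP; split; apply/eqP;
      [move: yy => h; lra|ring].
  by rewrite zc /z mulrACA e -invfM [f^* * f]mulrC divff // mulf_neq0.
have := out z zz.
have -> : 2 - f * z^* - f^* * z = 0.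
  have -> : f * z^* = 1 -i* y by rewrite zc mulrCA divff // mulr1.
  have -> : f^* * z = 1 +i* y by rewrite /z mulrCA divff // mulr1.
  by apply/eqP; rewrite eq_complex /=; apply/andP; split; apply/eqP; ring.
by rewrite mul0r sub0r oppr_gt0 => /(lt_trans K0); rewrite ltxx.
Qed.

Section Porism.
Variables (R : realType) (f g K : R[i]).
Hypothesis (K_gt0 : 0 < K).
Hypothesis outside : forall z : R[i], z * z^* = 1 ->
        0 < (2 - f * z^* - f^* * z) * (2 - g * z^* - g^* * z) - K.

Lemma f_in_disk : f * f^* < 1.
Proof. exact: focus_in_disk K_gt0 outside. Qed.

Lemma g_in_disk : g * g^* < 1.
Proof. by apply: (@focus_in_disk _ g f K K_gt0) => z /outside; rewrite mulrC. Qed.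

Lemma foci_off_circle z : z * z^* = 1 -> (z - f) * (z - g) != 0.
Proof.
move=> zz; rewrite mulf_neq0 // subr_eq0; apply/eqP => e.
  by have := f_in_disk; rewrite -e zz ltxx.
by have := g_in_disk; rewrite -e zz ltxx.
Qed.

Lemma foci_coef_neq0 z : z * z^* = 1 -> (1 - f^* * z) * (1 - g^* * z) != 0.
Proof.
move=> zz; have z0 := unit_neq0 zz.
have -> : (1 - f^* * z) * (1 - g^* * z) = z ^+ 2 * ((z - f) * (z - g))^*.
  by rewrite conjcM !conjcB (unit_conj zz); field.
by rewrite mulf_neq0 ?expf_neq0 // conjc_eq0 foci_off_circle.
Qed.

(** For a fixed vertex z, tangency of the chord with ends z and w is a quadratic
    equation in w.  Its roots are the two other vertices. *)
Lemma vertex_relations z z2 z3 : chord_triangle f g K z z2 z3 ->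
  (1 - f^* * z) * (1 - g^* * z) * (z2 + z3) =
     (f - z) * (1 - g^* * z) + (g - z) * (1 - f^* * z) + K * z /\
  (1 - f^* * z) * (1 - g^* * z) * (z2 * z3) = (z - f) * (z - g).
Proof.
move=> [[h1 h2 h3] [d12 d23 d31] [t12 t23 t31]].
set n := (1 - f^* * z) * (1 - g^* * z).
set b := _ + K * z.
have E w : tangent_chord f g K z w -> n * w ^+ 2 - b * w + (z - f) * (z - g) = 0.
  rewrite /tangent_chord => /eqP; rewrite -subr_eq0 => /eqP <-.
  by rewrite /n /b; ring.
have E2 := E _ t12.
have E3 : n * z3 ^+ 2 - b * z3 + (z - f) * (z - g) = 0.
  by apply: E; move: t31; rewrite /tangent_chord [z3 * z]mulrC [z3 + z]addrC.
have s : n * (z2 + z3) = b.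
  apply/eqP; rewrite -subr_eq0; rewrite -subr_eq0 in d23; apply/eqP/(mulfI d23).
  rewrite mulr0 -[RHS](subrr 0) -{1}E2 -E3; ring.
split=> //; apply/eqP; rewrite -subr_eq0 -oppr_eq0 -[X in _ == X]E2 -s; apply/eqP; ring.
Qed.

(** Tangency of the side opposite to z, expressed through the sum and product
    of z2 and z3, factors as (1 - f f') (1 - g g') - K times the quantity that
    is positive by hypothesis. *)
Lemma cayley z z2 z3 : chord_triangle f g K z z2 z3 ->
  K = (1 - f * f^*) * (1 - g * g^*).
Proof.
move=> T; have [s p] := vertex_relations T.
case: T => [[zz _ _] _ [_ t23 _]].
have n0 := foci_coef_neq0 zz; have z0 := unit_neq0 zz.
move: s p n0 t23; set n := (1 - f^* * z) * (1 - g^* * z) => s p n0 t23.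
pose F := 1 - f * f^*; pose G := 1 - g * g^*.
pose A := 2 - f * z^* - f^* * z; pose B := 2 - g * z^* - g^* * z.
have : z ^+ 2 * ((F * G - K) * (A * B - K)) = 0.
  have e : (n * f + n * (z2 * z3) * f^* - n * (z2 + z3)) * (n * g + n * (z2 * z3) * g^* -
    n * (z2 + z3))
     - K * (n * (z2 * z3)) * n = 0.
    move/eqP: t23; rewrite -subr_eq0 => /eqP t23.
    by rewrite -[RHS](mulr0 (n ^+ 2)) -t23; ring.
  rewrite -[RHS]e s p /n /F /G /A /B (unit_conj zz); by field.
move/eqP; rewrite !mulf_eq0 !(negbTE z0) /= (gt_eqF (outside zz)) orbF subr_eq0.
by move/eqP.
Qed.

(** With the conjugate relation, the three vertices are the solutions of
    z (z - f) (z - g) = l (1 - f' z) (1 - g' z), where l is their product. *)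
Lemma vertex_sum z z2 z3 : chord_triangle f g K z z2 z3 ->
  z + z2 + z3 = f + g + z * z2 * z3 * (f * g)^*.
Proof.
move=> T; have [s p] := vertex_relations T; have KE := cayley T.
case: T => [[zz _ _] _ _].
have n0 := foci_coef_neq0 zz; have z0 := unit_neq0 zz.
apply: (mulfI n0).
move: s p n0; set n := (1 - f^* * z) * (1 - g^* * z) => s p n0.
have -> : n * (z + z2 + z3) = n * z + n * (z2 + z3) by ring.
have -> : n * (f + g + z * z2 * z3 * (f * g)^*) = n * (f + g) + z * (n * (z2 * z3)) * (f^* * g^*).
  by rewrite conjcM; ring.
by rewrite s p KE /n; ring.
Qed.

Hypothesis porism : forall z : R[i], z * z^* = 1 ->
  exists z2 z3, chord_triangle f g K z z2 z3.

(** The cubic whose roots should be the vertices is stable under z -> 1 / z'.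
    If a root x is off the unit circle, then x and 1 / x' are two distinct roots
    whose product has modulus 1, so the third root has modulus 1.  The porism
    provides a triangle with that vertex. *)
Lemma triangle_with_product l : l * l^* = 1 ->
  exists z1 z2 z3, chord_triangle f g K z1 z2 z3 /\ z1 * z2 * z3 = l.
Proof.
move=> ll; have l0 := unit_neq0 ll.
pose s1 := f + g + l * (f * g)^*; pose s2 := f * g + l * (f + g)^*.
pose E x := x ^+ 3 - s1 * x ^+ 2 + s2 * x - l.
suff [z zz Ez] : exists2 z, z * z^* = 1 & E z = 0.
  have [z2 [z3 T]] := porism zz; exists z, z2, z3; split=> //.
  have [_ p] := vertex_relations T; apply: (mulfI (foci_coef_neq0 zz)).
  rewrite -mulrA mulrCA p; apply/eqP; rewrite -subr_eq0 -Ez /E /s1 /s2 conjcM conjcD.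
  by apply/eqP; ring.
have [x Ex] : exists x, E x = 0.
  have [x xE] := @GRing.solve_monicpoly R[i] 3 (fun i => nth 0 [:: l; - s2; s1] i) isT.
  exists x; rewrite /E xE !big_ord_recl big_ord0 /=; rewrite /bump /=; ring.
have x0 : x != 0.
  by apply/eqP => x0; move: Ex; rewrite /E x0 !expr0n /= !mulr0 subr0 addr0 sub0r => /eqP;
    rewrite oppr_eq0 (negbTE l0).
have xc0 : x^* != 0 by rewrite conjc_eq0.
have [xx|xx] := eqVneq (x * x^*) 1; first by exists x.
pose x' := (x^*)^-1.
have Ex' : E x' = 0.
  have Exc : x^* ^+ 3 - s1^* * x^* ^+ 2 + s2^* * x^* - l^* = 0.
    by rewrite -[RHS](conjc0 R) -Ex /E; ring.
  have e1 : s1^* = l^-1 * s2 by rewrite /s1 /s2 !(conjcD, conjcM) !conjcK (unit_conj ll); field.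
  have e2 : s2^* = l^-1 * s1 by rewrite /s1 /s2 !(conjcD, conjcM) !conjcK (unit_conj ll); field.
  move: Exc; rewrite e1 e2 (unit_conj ll) /E /x' => Exc.
  have -> : (x^*)^-1 ^+ 3 - s1 * (x^*)^-1 ^+ 2 + s2 * (x^*)^-1 - l = - l / x^* ^+ 3 *
    (x^* ^+ 3 - l^-1 * s2 * x^* ^+ 2 + l^-1 * s1 * x^* - l^-1) by field; apply/andP.
  by rewrite Exc mulr0.
have dx : x - x' != 0.
  rewrite subr_eq0; apply/eqP => e; move/eqP: xx; apply.
  by rewrite {1}e /x' mulVf.
have Q : x ^+ 2 + x * x' + x' ^+ 2 - s1 * (x + x') + s2 = 0.
  by apply: (mulfI dx); rewrite mulr0 -[RHS](subrr 0) -{1}Ex -Ex' /E; ring.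
(* the third root *)
pose y := s1 - x - x'.
have yl : x * x' * y = l.
  apply/eqP; rewrite -subr_eq0 -Ex /E.
  by rewrite -[X in _ == X]addr0 -[X in _ == _ + X](mulr0 (- x)) -Q /y; apply/eqP; ring.
exists y.
  have : (x * x' * y) * (x * x' * y)^* = 1 by rewrite yl.
  rewrite !conjcM /x' conjc_inv conjcK => <-; field; exact/andP.
rewrite /E -yl; have -> : s2 = - (x ^+ 2 + x * x' + x' ^+ 2) + s1 * (x + x').
  by apply/eqP; rewrite -subr_eq0 -Q; apply/eqP; ring.
by rewrite /y; ring.
Qed.

End Porism.

(** * Circumcircles of the family *)

Lemma laurent_three_roots (F : fieldType) (l0 l1 l2 z1 z2 z3 : F) :
  z1 != 0 -> z2 != 0 -> z3 != 0 -> z1 != z2 -> z2 != z3 -> z3 != z1 ->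
  l0 + l1 * z1 + l2 / z1 = 0 -> l0 + l1 * z2 + l2 / z2 = 0 -> l0 + l1 * z3 + l2 / z3 = 0 ->
  [/\ l0 = 0, l1 = 0 & l2 = 0].
Proof.
move=> n1 n2 n3 d12 d23 d31 e1 e2 e3.
have q z : z != 0 -> l0 + l1 * z + l2 / z = 0 -> l1 * z ^+ 2 + l0 * z + l2 = 0.
  by move=> z0 e; rewrite -[RHS](mulr0 z) -e; field.
have {}e1 := q _ n1 e1; have {}e2 := q _ n2 e2; have {}e3 := q _ n3 e3.
rewrite -subr_eq0 in d12; rewrite -subr_eq0 in d23; rewrite -subr_eq0 in d31.
have a12 : l1 * (z1 + z2) + l0 = 0.
  by apply: (mulfI d12); rewrite mulr0 -[RHS](subrr 0) -{1}e1 -e2; ring.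
have a23 : l1 * (z2 + z3) + l0 = 0.
  by apply: (mulfI d23); rewrite mulr0 -[RHS](subrr 0) -{1}e2 -e3; ring.
have h1 : l1 = 0.
  by apply: (mulfI d31); rewrite mulr0 -[RHS](subrr 0) -{1}a23 -a12; ring.
have h0 : l0 = 0 by rewrite -a12 h1; ring.
by split=> //; rewrite -e1 h1 h0; ring.
Qed.

(** The conjugates xc, yc, sc, pc are independent variables here, which makes
    the claim an identity of rational functions. *)
Lemma side_identity (F : fieldType) (x xc y yc k u v s sc p pc z1 z2 z3 : F) :
  z1 != 0 -> z2 != 0 -> z3 != 0 ->
  s = z1 + z2 + z3 - z1 * z2 * z3 * pc ->
  sc = z1^-1 + z2^-1 + z3^-1 - (z1 * z2 * z3)^-1 * p ->
  let l := z1 * z2 * z3 in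
  let d := x + y - s in let dc := xc + yc - sc in
  let I := x * d + l * dc + u * v * k - (x ^+ 2 - s * x + p) in
  let Ic := xc * dc + l^-1 * d + u * v * k - (xc ^+ 2 - sc * xc + pc) in
  let kap := sc - pc * x - xc in let kapc := s - p * xc - x in
  let II := (1 - x * xc) * (1 - p * pc) - kap * kapc - kap * d - kapc * dc
            - k * (u ^+ 2 + v ^+ 2 - u * v * (p + pc)) in
  (x + z1 * z2 * xc - (z1 + z2)) * (y + z1 * z2 * yc - (z1 + z2))
   - k * ((u - z1 * z2 * v) * (z1 * z2 * u - v)) =
  I - l * Ic * (z1 + z2) + (II + l * sc * Ic - pc * I) * (z1 * z2).
Proof.
by move=> n1 n2 n3 -> -> /=; field; apply/and3P.
Qed.

Section TrianglePower.
Variables (R : realType) (u v f g : R[i]).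
Hypotheses (uc : u^* = u) (vc : v^* = v).

(** The number l is the parameter of the triangle in the family. *)
Definition family_triangle (l z1 z2 z3 : R[i]) : Prop :=
  [/\ [/\ z1 * z1^* = 1, z2 * z2^* = 1 & z3 * z3^* = 1],
      [/\ z1 != z2, z2 != z3 & z3 != z1],
      z1 * z2 * z3 = l & z1 + z2 + z3 = f + g + l * (f * g)^*].

Lemma family_triangle_rot l z1 z2 z3 :
  family_triangle l z1 z2 z3 -> family_triangle l z2 z3 z1.
Proof.
by move=> [[h1 h2 h3] [d1 d2 d3] <- h]; split=> //; [ring|rewrite -h; ring].
Qed.

Lemma family_triangle_sums l z1 z2 z3 : family_triangle l z1 z2 z3 ->
  [/\ z1 != 0, z2 != 0 & z3 != 0] /\
  [/\ f + g = z1 + z2 + z3 - z1 * z2 * z3 * (f * g)^*,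
      (f + g)^* = z1^-1 + z2^-1 + z3^-1 - (z1 * z2 * z3)^-1 * (f * g),
      l = z1 * z2 * z3, l^* = (z1 * z2 * z3)^-1 & l * l^* = 1].
Proof.
move=> [[h1 h2 h3] _ hl hs].
have [n1 n2 n3] := And3 (unit_neq0 h1) (unit_neq0 h2) (unit_neq0 h3).
have lc : l^* = (z1 * z2 * z3)^-1.
  by rewrite -hl !conjcM (unit_conj h1) (unit_conj h2) (unit_conj h3) !invfM.
split=> //; split=> //.
- by rewrite hs hl; ring.
- move/(congr1 conjc): hs; rewrite !conjcE (unit_conj h1) (unit_conj h2) (unit_conj h3) => ->.
  by rewrite lc; ring.
- by rewrite lc -hl divff // !mulf_neq0.
Qed.

Definition focal_product (x : R[i]) := (x - f) * (x - g).

(** The coefficient of the parameter in the power of x, see circum_power. *)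
Definition focal_polar (x : R[i]) := (f + g)^* - (f * g)^* * x - x^*.

(** The power of x with respect to the circumcircle of the triangle of
    parameter l, see circum_powerP; it is real and affine in l. *)
Definition circum_power (x l : R[i]) :=
  (u ^+ 2 + v ^+ 2) * (x * x^* - 1) +
  u * v * ((focal_product x + l * focal_polar x) + (focal_product x + l * focal_polar x)^*).

Lemma focal_polar_unit x : x * x^* = 1 -> focal_polar x = - x * (focal_product x)^*.
Proof.
move=> xx; have x0 := unit_neq0 xx.
by rewrite /focal_polar /focal_product !conjcE (unit_conj xx); field.
Qed.

(** The equation z (z - f) (z - g) = l (1 - f' z) (1 - g' z) of the vertices. *)
Lemma vertex_focal_product l z1 z2 z3 : family_triangle l z1 z2 z3 ->
  focal_product z1 = l * z1 * (focal_product z1)^*.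
Proof.
move=> T; have [[n1 n2 n3] [hs hsc hl _ _]] := family_triangle_sums T.
case: T => [[h1 _ _] _ _ _].
have -> : (focal_product z1)^* = z1^-1 ^+ 2 - (f + g)^* / z1 + (f * g)^*.
  by rewrite /focal_product !(conjcM, conjcB, conjcD) (unit_conj h1); ring.
have -> : focal_product z1 = z1 ^+ 2 - (f + g) * z1 + f * g by rewrite /focal_product; ring.
move: (f + g) ((f + g)^*) (f * g) ((f * g)^*) hs hsc => s sc p pc -> ->.
by rewrite hl; field; apply/and3P.
Qed.

Lemma circum_power_vertex l z1 z2 z3 : family_triangle l z1 z2 z3 -> circum_power z1 l = 0.
Proof.
move=> T; have e := vertex_focal_product T.
case: T => [[h1 _ _] _ _ _].
have -> : circum_power z1 l = u * v * ((focal_product z1 + l * focal_polar z1) +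
  (focal_product z1 + l * focal_polar z1)^*).
  by rewrite /circum_power h1; ring.
have -> : focal_product z1 + l * focal_polar z1 = 0.
  by rewrite (focal_polar_unit h1) {1}e; ring.
by rewrite conjc0 addr0 mulr0.
Qed.

(** The square of the Euclidean norm of the vector of coordinate x. *)
Definition sqr_length (x : R[i]) := (u * x + v * x^*) * (u * x^* + v * x).

(** Both terms on the left have the quadratic part of a squared distance, so
    their difference is affine in x.  Its slope m vanishes when d is the
    circumcentre. *)
Lemma circum_power_sqr_length l x d :
  let m := (u ^+ 2 + v ^+ 2) * d^* + 2 * (u * v) * d - u * v * (f + g + l * (f * g)^* + l^*) in
  circum_power x l - sqr_length (x - d) =
  m * x + m^* * x^* + (circum_power 0 l - sqr_length d).
Proof.
rewrite /circum_power /sqr_length /focal_product /focal_polar.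
rewrite !(conjcE, uc, vc); ring.
Qed.

(** The power minus the squared distance to d is affine in x up to a constant.
    If d is equidistant from the vertices, this affine function vanishes at
    three points of the unit circle, hence everywhere; conversely d is found
    by solving for a zero slope, which is possible since u^2 <> v^2. *)
Lemma circum_powerP l z1 z2 z3 x : u ^+ 2 - v ^+ 2 != 0 -> family_triangle l z1 z2 z3 ->
  circum_power x l = 0 <->
  exists d, [/\ sqr_length (z2 - d) = sqr_length (z1 - d),
                sqr_length (z3 - d) = sqr_length (z1 - d) &
                sqr_length (x - d) = sqr_length (z1 - d)].
Proof.
move=> uv0 T; have [[n1 n2 n3] _] := family_triangle_sums T.
have p1 := circum_power_vertex T; have T2 := family_triangle_rot T.
have p2 := circum_power_vertex T2; have p3 := circum_power_vertex (family_triangle_rot T2).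
have [[h1 h2 h3] [d12 d23 d31] _ _] := T.
pose c d := circum_power 0 l - sqr_length d.
split=> [p0|[d [e2 e3 e0]]].
  (* r and d solve m = 0, where m is the slope in circum_power_sqr_length *)
  pose r := u * v * (f + g + l * (f * g)^* + l^*).
  pose d := ((u ^+ 2 + v ^+ 2) * r^* - 2 * (u * v) * r) / (u ^+ 2 - v ^+ 2) ^+ 2.
  have m0 : (u ^+ 2 + v ^+ 2) * d^* + 2 * (u * v) * d - r = 0.
    rewrite /d conjcM conjc_inv !(conjcB, conjcD, conjcM, conjcX, conjcK, conjc_nat, uc, vc).
    by field.
  have S y : circum_power y l - sqr_length (y - d) = c d.
    by rewrite (circum_power_sqr_length l y d) -/r m0 conjc0 /c; ring.
  exists d; split; apply/eqP; rewrite -subr_eq0; apply/eqP.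
  - by rewrite -[RHS](subrr (c d)) -{1}(S z1) -(S z2) p1 p2; ring.
  - by rewrite -[RHS](subrr (c d)) -{1}(S z1) -(S z3) p1 p3; ring.
  - by rewrite -[RHS](subrr (c d)) -{1}(S z1) -(S x) p1 p0; ring.
set m := (u ^+ 2 + v ^+ 2) * d^* + 2 * (u * v) * d - u * v * (f + g + l * (f * g)^* + l^*).
have S y : circum_power y l - sqr_length (y - d) = m * y + m^* * y^* + c d.
  exact: circum_power_sqr_length.
pose q := c d + sqr_length (z1 - d).
have aff y : y * y^* = 1 -> circum_power y l = 0 -> sqr_length (y - d) = sqr_length (z1 - d) ->
   q + m * y + m^* / y = 0.
  move=> hy py ey; have := S y; rewrite py ey (unit_conj hy) /q => /eqP.
  rewrite sub0r eq_sym -addr_eq0 => /eqP <-; ring.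
have [q0 m0 _] := laurent_three_roots n1 n2 n3 d12 d23 d31 (aff _ h1 p1 erefl) (aff _ h2 p2 e2)
  (aff _ h3 p3 e3).
have := S x; rewrite m0 conjc0 e0 => /eqP; rewrite subr_eq => /eqP ->.
by rewrite -[RHS]q0 /q; ring.
Qed.

(** * Isogonal conjugates as a linear system *)

Definition chord_form (x p s : R[i]) := x + p * x^* - s.

(** The counterpart of isogonal_side, with k proportional to the product of the
    distances; see isogonal_side_chord. *)
Definition side_equation (x y k z1 z2 : R[i]) : Prop :=
  chord_form x (z1 * z2) (z1 + z2) * chord_form y (z1 * z2) (z1 + z2) =
  k * ((u - z1 * z2 * v) * (z1 * z2 * u - v)).

Definition weight := u ^+ 2 + v ^+ 2 - u * v * (f * g + (f * g)^*).

(** The inhomogeneous term of the second equation of isogonal_system. *)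
Definition polar_const (x : R[i]) :=
  (1 - x * x^*) * (1 - (f * g) * (f * g)^*) - focal_polar x * (focal_polar x)^*.

(** The conditions for x and y to be the foci of a conic tangent to the three
    sides, where d = x + y - (f + g) and k is as in side_equation.  They come
    from comparing the dual equation of that conic with the one of the inner
    ellipse, modulo the dual equations that vanish on the three sides. *)
Definition isogonal_system (l x d k : R[i]) : Prop :=
  x * d + l * d^* + u * v * k = focal_product x /\
  k * weight = polar_const x - focal_polar x * d - (focal_polar x)^* * d^*.

(** In the dual coordinates s = z1 + z2 and p = z1 z2 of a side, the defect of
    side_equation is affine, with coefficients built from the defects I and II
    of the two equations of the system. *)
Lemma side_equationE l z1 z2 z3 x y k : k^* = k -> family_triangle l z1 z2 z3 ->
  let d := x + y - (f + g) in
  let I := x * d + l * d^* + u * v * k - focal_product x in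
  let II := polar_const x - focal_polar x * d - (focal_polar x)^* * d^* - k * weight in
  chord_form x (z1 * z2) (z1 + z2) * chord_form y (z1 * z2) (z1 + z2) -
  k * ((u - z1 * z2 * v) * (z1 * z2 * u - v)) =
  I - l * I^* * (z1 + z2) + (II + l * (f + g)^* * I^* - (f * g)^* * I) * (z1 * z2).
Proof.
move=> kc T d I II.
have [[n1 n2 n3] [hs hsc hl hlc _]] := family_triangle_sums T.
have dcE : d^* = x^* + y^* - (f + g)^* by rewrite /d conjcB (conjcD x y).
have IE : I = x * d + l * d^* + u * v * k - (x ^+ 2 - (f + g) * x + f * g).
  by rewrite /I /focal_product; ring.
have IcE : I^* = x^* * d^* + l^* * d + u * v * k - (x^* ^+ 2 - (f + g)^* * x^* + (f * g)^*).
  by rewrite IE !(conjcE, uc, vc, kc).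
have kapcE : (focal_polar x)^* = f + g - f * g * x^* - x.
  by rewrite /focal_polar !conjcE.
have := side_identity x x^* y y^* k u v n1 n2 n3 hs hsc.
have lV : l^-1 = l^* by rewrite hlc hl.
cbv zeta; rewrite -hl lV -/d -dcE -IE -IcE -kapcE -/(focal_polar x) => ->.
by rewrite /II /polar_const /weight.
Qed.

(** The three sides are not concurrent, so an affine function of the dual
    coordinates that vanishes on them is zero. *)
Lemma isogonal_systemP l z1 z2 z3 x y k : k^* = k -> family_triangle l z1 z2 z3 ->
  [/\ side_equation x y k z1 z2, side_equation x y k z2 z3 & side_equation x y k z3 z1] <->
  isogonal_system l x (x + y - (f + g)) k.
Proof.
move=> kc T.
have T2 := family_triangle_rot T; have T3 := family_triangle_rot T2.
have [[n1 n2 n3] [hs hsc hl hlc ll]] := family_triangle_sums T.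
have e1 := side_equationE x y kc T; have e2 := side_equationE x y kc T2.
have e3 := side_equationE x y kc T3.
move: e1 e2 e3; rewrite /side_equation /isogonal_system.
set d := x + y - _; set I := x * d + _ + _ - _.
set II := polar_const x - _ - _ - _ => /= e1 e2 e3.
split=> [[s1 s2 s3]|[i1 i2]].
  have l0 : l != 0 by rewrite hl !mulf_neq0.
  have [_ [d12 d23 d31] _ _] := T.
  set a2 := II + _ - _ in e1 e2 e3.
  have r1 : I - l * I^* * (z1 + z2) + a2 * (z1 * z2) = 0 by rewrite -e1 s1 subrr.
  have r2 : I - l * I^* * (z2 + z3) + a2 * (z2 * z3) = 0 by rewrite -e2 s2 subrr.
  have r3 : I - l * I^* * (z3 + z1) + a2 * (z3 * z1) = 0 by rewrite -e3 s3 subrr.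
  pose b0 := I - l * I^* * (z1 + z2 + z3).
  have [h0 h1 h2] : [/\ b0 = 0, l * I^* = 0 & a2 * l = 0].
    apply: (laurent_three_roots n1 n2 n3 d12 d23 d31).
    - by rewrite -r2 /b0 hl; field.
    - by rewrite -r3 /b0 hl; field.
    - by rewrite -r1 /b0 hl; field.
  have I0 : I = 0 by rewrite -h0 /b0 h1; ring.
  split; first by apply/eqP; rewrite -subr_eq0 -/I I0.
  move/eqP: h2; rewrite mulf_eq0 (negbTE l0) orbF /a2 I0 conjc0 !mulr0 addr0 subr0 => /eqP II0.
  by apply/eqP; rewrite eq_sym -subr_eq0 -/II II0.
have I0 : I = 0 by rewrite /I i1 subrr.
have II0 : II = 0 by rewrite /II i2 subrr.
move: e1 e2 e3; rewrite I0 II0 conjc0 => e1 e2 e3.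
split; apply/eqP; rewrite -subr_eq0; apply/eqP.
- by rewrite e1; ring.
- by rewrite e2; ring.
- by rewrite e3; ring.
Qed.

Lemma power_identity (F : fieldType) (x xc s sc p pc z1 z2 z3 a b : F) :
  z1 != 0 -> z2 != 0 -> z3 != 0 ->
  s = z1 + z2 + z3 - z1 * z2 * z3 * pc ->
  sc = z1^-1 + z2^-1 + z3^-1 - (z1 * z2 * z3)^-1 * p ->
  let l := z1 * z2 * z3 in
  let X1 := x + z2 * z3 * xc - (z2 + z3) in
  let X2 := x + z3 * z1 * xc - (z3 + z1) in
  let X3 := x + z1 * z2 * xc - (z1 + z2) in
  let L1 := (a - z2 * z3 * b) * (z2 * z3 * a - b) in
  let L2 := (a - z3 * z1 * b) * (z3 * z1 * a - b) in
  let L3 := (a - z1 * z2 * b) * (z1 * z2 * a - b) in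
  z1 * (z2 - z3) * L1 * (X2 * X3) + z2 * (z3 - z1) * L2 * (X3 * X1) + z3 * (z1 -
    z2) * L3 * (X1 * X2) =
  l * ((z1 - z2) * (z2 - z3) * (z3 - z1)) *
   ((a ^+ 2 + b ^+ 2) * (x * xc - 1) +
    a * b * ((x ^+ 2 - s * x + p + l * (sc - pc * x - xc)) +
             (xc ^+ 2 - sc * xc + pc + l^-1 * (s - p * xc - x)))).
Proof.
by move=> n1 n2 n3 -> -> /=; field; apply/and3P.
Qed.

(** The equation of the circumcircle in barycentric coordinates: the forms X
    measure the distances to the sides and the L the squared side lengths. *)
Lemma circum_power_sides l z1 z2 z3 x : family_triangle l z1 z2 z3 ->
  let X1 := chord_form x (z2 * z3) (z2 + z3) in
  let X2 := chord_form x (z3 * z1) (z3 + z1) in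
  let X3 := chord_form x (z1 * z2) (z1 + z2) in
  let L1 := (u - z2 * z3 * v) * (z2 * z3 * u - v) in
  let L2 := (u - z3 * z1 * v) * (z3 * z1 * u - v) in
  let L3 := (u - z1 * z2 * v) * (z1 * z2 * u - v) in
  z1 * (z2 - z3) * L1 * (X2 * X3) + z2 * (z3 - z1) * L2 * (X3 * X1) + z3 * (z1 -
    z2) * L3 * (X1 * X2) =
  l * ((z1 - z2) * (z2 - z3) * (z3 - z1)) * circum_power x l.
Proof.
move=> T; have [[n1 n2 n3] [hs hsc hl hlc _]] := family_triangle_sums T.
have := power_identity x x^* u v n1 n2 n3 hs hsc.
have lV : l^-1 = l^* by rewrite hlc hl.
cbv zeta; rewrite -hl lV /chord_form => ->; congr (_ * _).
rewrite /circum_power /focal_product /focal_polar.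
rewrite [in RHS]conjcD; congr (_ + _ * (_ + _)); first by ring.
by rewrite !conjcE; ring.
Qed.

Lemma vertex_on_two_sides x z1 z2 z3 : z1 * z1^* = 1 -> z1 != 0 -> z2 != z3 ->
  chord_form x (z1 * z2) (z1 + z2) = 0 -> chord_form x (z3 * z1) (z3 + z1) = 0 -> x = z1.
Proof.
move=> h1 n1 d23 e2 e3; rewrite /chord_form in e2 e3.
have : (z2 - z3) * (z1 * x^* - 1) = 0.
  by rewrite -[RHS](subrr 0) -{1}e2 -e3; ring.
move/eqP; rewrite mulf_eq0 subr_eq0 (negbTE d23) /= subr_eq0 => /eqP e.
have xc : x^* = z1^* by apply: (mulfI n1); rewrite e h1.
by rewrite -[x]conjcK xc conjcK.
Qed.

Hypothesis uv2 : u ^+ 2 - v ^+ 2 != 0.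

(** For p of modulus 1 the two terms of each factor have different moduli. *)
Lemma axis_coef_neq0 p : p * p^* = 1 -> (u - p * v) * (p * u - v) != 0.
Proof.
move=> pp; have p0 := unit_neq0 pp.
have H (s t : R[i]) : s ^+ 2 - t ^+ 2 != 0 -> s^* = s -> t^* = t -> s - p * t != 0.
  move=> st sc tc; apply/eqP => /eqP; rewrite subr_eq0 => /eqP e; move/eqP: st; apply.
  have e' : s = p^* * t by rewrite -{1}sc e conjcM tc.
  by rewrite expr2 {1}e e' mulrACA pp; ring.
rewrite mulf_neq0 //; first exact: H.
rewrite -oppr_eq0 opprB; apply: H => //.
by rewrite -oppr_eq0 opprB.
Qed.

(** The forms of y on the three sides have a constant nonzero combination.
    Multiplied by the three forms of x, it becomes k times the barycentric
    equation of the circumcircle at x, which is zero.  So x is on a side, and a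
    point of the circumcircle on a side is a vertex. *)
Lemma concyclic_isogonal_vertex l z1 z2 z3 x y k : family_triangle l z1 z2 z3 ->
  side_equation x y k z1 z2 -> side_equation x y k z2 z3 -> side_equation x y k z3 z1 ->
  circum_power x l = 0 -> [\/ x = z1, x = z2 | x = z3].
Proof.
move=> T; wlog : z1 z2 z3 T / chord_form x (z1 * z2) (z1 + z2) = 0.
  move=> wl s3 s1 s2 p0.
  have T2 := family_triangle_rot T; have T3 := family_triangle_rot T2.
  have [[n1 n2 n3] [_ _ hl _ ll]] := family_triangle_sums T.
  have [_ [d12 d23 d31] _ _] := T.
  have := circum_power_sides x T; rewrite p0 mulr0 /=.
  move: s1 s2 s3; rewrite /side_equation.
  set X1 := chord_form x (z2 * z3) _; set X2 := chord_form x (z3 * z1) _.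
  set X3 := chord_form x (z1 * z2) _.
  set Y1 := chord_form y (z2 * z3) _; set Y2 := chord_form y (z3 * z1) _.
  set Y3 := chord_form y (z1 * z2) _.
  move=> s1 s2 s3 e.
  pose V := (z1 - z2) * (z2 - z3) * (z3 - z1).
  have V0 : V != 0 by rewrite /V !mulf_neq0 ?subr_eq0.
  have sumY : z1 * (z2 - z3) * Y1 + z2 * (z3 - z1) * Y2 + z3 * (z1 - z2) * Y3 = - V.
    by rewrite /Y1 /Y2 /Y3 /V /chord_form; ring.
  have : X1 * X2 * X3 * - V = 0.
    rewrite -sumY.
    have -> : X1 * X2 * X3 * (z1 * (z2 - z3) * Y1 + z2 * (z3 - z1) * Y2 + z3 * (z1 - z2) * Y3) =
       z1 * (z2 - z3) * (X1 * Y1) * (X2 * X3) + z2 * (z3 - z1) * (X2 * Y2) * (X3 * X1)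
       + z3 * (z1 - z2) * (X3 * Y3) * (X1 * X2) by ring.
    by rewrite s1 s2 s3 -[RHS](mulr0 k) -e; ring.
  move/eqP; rewrite mulf_eq0 oppr_eq0 (negbTE V0) orbF !mulf_eq0 => /orP[/orP[]|] /eqP h.
  - by case: (wl z2 z3 z1 T2 h s1 s2 s3 p0) => e'; [apply: Or32|apply: Or33|apply: Or31].
  - by case: (wl z3 z1 z2 T3 h s2 s3 s1 p0) => e'; [apply: Or33|apply: Or31|apply: Or32].
  - exact: wl h s3 s1 s2 p0.
move=> X3 _ _ _ p0.
have T2 := family_triangle_rot T; have T3 := family_triangle_rot T2.
have [[n1 n2 n3] [_ _ hl _ ll]] := family_triangle_sums T.
have [[h1 h2 h3] [d12 d23 d31] _ _] := T.
have pp : (z1 * z2) * (z1 * z2)^* = 1 by rewrite conjcM mulrACA h1 h2 mulr1.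
have a0 := axis_coef_neq0 pp.
have := circum_power_sides x T; rewrite p0 mulr0 /= X3 !(mulr0, mul0r, add0r) => /eqP.
have c0 : z3 * (z1 - z2) * ((u - z1 * z2 * v) * (z1 * z2 * u - v)) != 0.
  by rewrite mulf_neq0 // mulf_neq0 // subr_eq0.
rewrite mulf_eq0 (negbTE c0) mulf_eq0 /= => /orP[] /eqP h.
  apply: Or32; apply: (@vertex_on_two_sides x z2 z3 z1) => //.
apply: Or31; exact: (@vertex_on_two_sides x z1 z2 z3).
Qed.
End TrianglePower.

(** * The locus at a parameter of tangency *)

(** The number W = G' A' h has the same modulus as (1 - r) h h', and the last
    hypothesis makes this real number the real part of W; so W is equal to it,
    which is G' D = 0. *)
Lemma isometric_real_part (R : realType) (A G D h r : R[i]) :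
  r^* = r -> A * A^* = (1 - r) ^+ 2 -> G * G^* = h * h^* ->
  D = A^* * h - (1 - r) * G -> G != 0 -> G^* * D + G * D^* = 0 -> D = 0.
Proof.
move=> rc AA GG DE G0 e.
have Gc0 : G^* != 0 by rewrite conjc_eq0.
pose W := G^* * A^* * h.
have Wc : W^* = G * A * h^* by rewrite /W !conjcM !conjcK.
have DcE : D^* = A * h^* - (1 - r) * G^* by rewrite DE !(conjcB, conjcM, conjcK, conjc1, rc).
have GD : G^* * D = W - (1 - r) * (h * h^*) by rewrite DE -GG /W; ring.
have GDc : G * D^* = W^* - (1 - r) * (h * h^*) by rewrite DcE -GG Wc; ring.
have WW : W * W^* = (h * h^*) ^+ 2 * (1 - r) ^+ 2.
  by rewrite -AA expr2 -{1}GG Wc /W; ring.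
have S : W + W^* = 2 * (1 - r) * (h * h^*).
  by apply/eqP; rewrite -subr_eq0 -e GD GDc; apply/eqP; ring.
clearbody W.
have : (W - W^*) ^+ 2 = 0.
  have -> : (W - W^*) ^+ 2 = (W + W^*) ^+ 2 - 4 * (W * W^*) by ring.
  by rewrite S WW; ring.
move/eqP; rewrite expf_eq0 /= subr_eq0 => /eqP Wr.
apply: (mulfI Gc0); rewrite mulr0 GD; apply: (@mulfI _ 2); first by rewrite pnatr_eq0.
have -> : 2 * (W - (1 - r) * (h * h^*)) = W + W - 2 * (1 - r) * (h * h^*) by ring.
by rewrite mulr0 -S {2}Wr subrr.
Qed.

Section Locus.
Variables (R : realType) (u v f g : R[i]).
Hypotheses (uc : u^* = u) (vc : v^* = v).
Hypothesis weight0 : weight u v f g != 0.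
Hypothesis uv0 : u * v != 0.
Hypothesis uv2 : u ^+ 2 - v ^+ 2 != 0.

Local Notation w := (weight u v f g).
Local Notation kap := (focal_polar f g).
Local Notation pow := (circum_power u v f g).

Lemma weight_conj : w^* = w.
Proof. by rewrite /weight !(conjcE, uc, vc); ring. Qed.

Lemma polar_const_conj x : (polar_const f g x)^* = polar_const f g x.
Proof. by rewrite /polar_const /focal_polar !conjcE; ring. Qed.

(** The effect of k in the first equation of isogonal_system once k is
    eliminated; it is 0 when the outer ellipse is a circle. *)
Definition aspect := u * v / w.

(** By circle_power, x lies on the circumcircle of parameter l when l is at
    distance |circle_radius x| from circle_center x in the parameter plane. *)
Definition circle_radius x := x - aspect * kap x.
Definition circle_center x := aspect * (kap x)^*.
Definition locus_rhs x := focal_product f g x - aspect * polar_const f g x.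

Lemma aspect_conj : aspect^* = aspect.
Proof. by rewrite /aspect !conjcM conjc_inv uc vc weight_conj. Qed.

Lemma isogonal_system_solve l x d k :
  isogonal_system u v f g l x d k <->
  circle_radius x * d + (l - circle_center x) * d^* = locus_rhs x /\
  k = (polar_const f g x - kap x * d - (kap x)^* * d^*) / w.
Proof.
have W0 := weight0.
rewrite /isogonal_system /circle_radius /circle_center /locus_rhs /aspect;
  split=> [[e1 e2]|[e1 ->]].
  have ke : k = (polar_const f g x - kap x * d - (kap x)^* * d^*) / w by rewrite -e2 mulfK.
  by split=> //; rewrite -e1 ke; field.
split; last by rewrite mulfVK.
apply/eqP; rewrite -subr_eq0; apply/eqP; rewrite -[RHS](subrr (focal_product f g x -
  u * v / w * polar_const f g x)) -{1}e1.
by move: (kap x) ((kap x)^*) (polar_const f g x) (focal_product f g x) => ? ? ? ?; field.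
Qed.

Lemma circle_power l x : l * l^* = 1 ->
  (circle_radius x * (circle_radius x)^* -
   (l - circle_center x) * (l - circle_center x)^*) * w = pow x l.
Proof.
move=> ll; have W0 := weight0.
rewrite /circle_radius /circle_center.
have -> : (x - aspect * kap x) * (x - aspect * kap x)^* - (l - aspect * (kap x)^*) * (l -
  aspect * (kap x)^*)^* =
   x * x^* - l * l^* - aspect * (x * (kap x)^* + x^* * kap x - l * kap x - l^* * (kap x)^*).
  move: (kap x) aspect aspect_conj => k e ec; by rewrite !(conjcB, conjcM, conjcK, ec); ring.
rewrite ll.
have -> : forall t s : R[i], (t - aspect * s) * w = t * w - u * v * s.
  by move=> t s; rewrite /aspect; field.
by rewrite /weight /circum_power /focal_polar /focal_product !conjcE; ring.
Qed.

(** The part of the power of x that does not depend on the parameter. *)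
Definition mean_power x := (u ^+ 2 + v ^+ 2) * (x * x^* - 1) +
  u * v * (focal_product f g x + (focal_product f g x)^*).

Lemma circum_powerE x l : pow x l = mean_power x + u * v * (l * kap x + l^* * (kap x)^*).
Proof.
rewrite /circum_power /mean_power (conjcD (focal_product f g x)) (conjcM l).
by move: (focal_product f g x) (kap x) => G k; ring.
Qed.

Lemma mean_power_conj x : (mean_power x)^* = mean_power x.
Proof. by rewrite /mean_power /focal_product !(conjcE, uc, vc); ring. Qed.

Hypothesis foci_off : forall z : R[i], z * z^* = 1 -> focal_product f g z != 0.

(** If the power of x did not depend on the parameter, it would be
    (x x' - 1) w; being zero, it would put x on the unit circle.  There
    focal_polar x is - x times the conjugate of focal_product x, which is
    nonzero as the foci are inside the unit disk. *)
Lemma focal_polar_neq0 x : mean_power x ^+ 2 =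
  4 * (u * v) ^+ 2 * (kap x * (kap x)^*) -> kap x != 0.
Proof.
move=> e; apply/eqP => k0; move: e; rewrite k0 mul0r mulr0 => /eqP; rewrite expf_eq0 /= => /eqP e.
have xE : x = f + g - (f * g) * x^*.
  have : (kap x)^* = 0 by rewrite k0 conjc0.
  by rewrite /focal_polar !conjcE => h; apply/eqP; rewrite -subr_eq0 -oppr_eq0 -[X in _ == X]h;
    apply/eqP; ring.
have xcE : x^* = (f + g)^* - (f * g)^* * x.
  by rewrite {1}xE !conjcE.
have : (x * x^* - 1) * w = 0.
  rewrite -e /mean_power /weight.
  have -> : focal_product f g x = f * g * (1 - x * x^*).
    have -> : focal_product f g x = x ^+ 2 - (f + g) * x + f * g by rewrite /focal_product; ring.
    have -> : f + g = x + (f * g) * x^* by rewrite {1}xE subrK.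
    by ring.
  by rewrite !conjcE; ring.
move/eqP; rewrite mulf_eq0 (negbTE weight0) orbF subr_eq0 => /eqP xx.
have := foci_off xx; have := focal_polar_unit f g xx; rewrite k0 => /eqP.
rewrite eq_sym mulf_eq0 oppr_eq0 (negbTE (unit_neq0 xx)) /= conjc_eq0 => /eqP ->.
by rewrite eqxx.
Qed.

(** The power of x is a real affine function of l.  By hypothesis its constant
    term is as large as the amplitude of its variable part, so it has exactly
    one zero l0 on the unit circle, and there a double one. *)
Lemma tangency x : mean_power x ^+ 2 = 4 * (u * v) ^+ 2 * (kap x * (kap x)^*) ->
  exists l0 q, [/\ l0 * l0^* = 1, q^* = q, q != 0, kap x = q * l0^* &
    forall l, l * l^* = 1 -> pow x l = - (w * (aspect * q)) * ((l - l0) * (l - l0)^*)].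
Proof.
move=> e; have k0 := focal_polar_neq0 e.
pose l0 := - mean_power x / (2 * (u * v) * kap x).
have d0 : 2 * (u * v) * kap x != 0 by rewrite mulf_neq0 // mulf_neq0 // pnatr_eq0.
have kc0 : (kap x)^* != 0 by rewrite conjc_eq0.
have d0c : 2 * (u * v) * (kap x)^* != 0 by rewrite mulf_neq0 // mulf_neq0 // pnatr_eq0.
have l0c : l0^* = - mean_power x / (2 * (u * v) * (kap x)^*).
  by rewrite /l0 !(conjcM, conjcN, conjc_inv, mean_power_conj, conjc_nat, uc, vc).
have ll : l0 * l0^* = 1.
  have -> : l0 * l0^* = mean_power x ^+ 2 / ((2 * (u * v) * kap x) * (2 * (u * v) * (kap x)^*)).
    by rewrite l0c /l0 mulrACA mulrNN -expr2 -invfM.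
  rewrite e -[RHS](divff (mulf_neq0 d0 d0c)); congr (_ / _); ring.
have lc0 := unit_neq0 ll.
have qE : l0 * kap x = - mean_power x / (2 * (u * v)).
  have [? ?] : u != 0 /\ v != 0 by move: uv0; rewrite mulf_eq0 negb_or => /andP.
  by rewrite /l0; field; rewrite k0; apply/and3P; split.
have kE : kap x = l0 * kap x * l0^* by rewrite mulrAC ll mul1r.
have qc : (l0 * kap x)^* = l0 * kap x.
  by rewrite qE !(conjcM, conjcN, conjc_inv, mean_power_conj, conjc_nat, uc, vc).
exists l0, (l0 * kap x); split=> //; first by rewrite mulf_neq0.
move=> l hl.
have pE : mean_power x = - (2 * (u * v) * (l0 * kap x)).
  by rewrite qE mulrC divfK ?opprK // mulf_neq0 // pnatr_eq0.
rewrite circum_powerE pE.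
move: qc kE; set q := l0 * kap x => qc kE.
rewrite kE (conjcM q) qc conjcK.
have -> : w * (aspect * q) = u * v * q by rewrite /aspect; field; exact: weight0.
have -> : (l - l0) * (l - l0)^* = l * l^* + l0 * l0^* - l * l0^* - l^* * l0 by rewrite conjcB;
  ring.
by rewrite hl ll; ring.
Qed.

Section Tangent.
Variables (x l0 q : R[i]).
Hypotheses (ll0 : l0 * l0^* = 1) (qc : q^* = q) (q0 : q != 0) (kapE : kap x = q * l0^*).
Hypothesis powE : forall l, l * l^* = 1 ->
  pow x l = - (w * (aspect * q)) * ((l - l0) * (l - l0)^*).

Local Notation r := (aspect * q).
Local Notation h := (locus_rhs x).
Local Notation al := (circle_radius x).

(** The numerator of Cramer's rule at l0; it is zero when the system, which is
    degenerate at l0, has a solution. *)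
Definition vertex_defect := al^* * h - (l0 - circle_center x) * h^*.

Lemma aspect_neq0 : aspect != 0.
Proof. by rewrite /aspect mulf_neq0 // invr_eq0. Qed.

Lemma aspect_q_neq0 : r != 0.
Proof. by rewrite mulf_neq0 // aspect_neq0. Qed.

Lemma aspect_q_conj : r^* = r.
Proof. by rewrite conjcM aspect_conj qc. Qed.

Lemma circle_centerE : circle_center x = r * l0.
Proof. by rewrite /circle_center kapE conjcM conjcK qc mulrA. Qed.

Lemma pow_tangent : pow x l0 = 0.
Proof. by rewrite powE // subrr mul0r mulr0. Qed.

Lemma pow_eq0 l : l * l^* = 1 -> pow x l = 0 -> l = l0.
Proof.
move=> ll; rewrite powE // => /eqP.
have c0 : - (w * r) != 0 by rewrite oppr_eq0 mulf_neq0 // aspect_q_neq0.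
by rewrite mulf_eq0 (negbTE c0) /= mulf_eq0 conjc_eq0 orbb subr_eq0 => /eqP.
Qed.

Lemma circle_radius_norm : al * al^* = (1 - r) ^+ 2.
Proof.
have := circle_power x ll0; rewrite pow_tangent => /eqP.
rewrite mulf_eq0 (negbTE weight0) orbF subr_eq0 circle_centerE => /eqP ->.
have -> : l0 - r * l0 = (1 - r) * l0 by ring.
by rewrite conjcM conjcB conjc1 aspect_q_conj mulrACA ll0 mulr1 expr2.
Qed.

(** At l0 the two coefficients of the equation have equal moduli, and
    vertex_defect = 0 is the compatibility of the equation with its conjugate.
    If both coefficients were zero, x would be l0', on the unit circle. *)
Lemma tangent_solution : vertex_defect = 0 -> x * x^* != 1 ->
  exists d, al * d + (l0 - circle_center x) * d^* = h.
Proof.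
rewrite /vertex_defect => /eqP; rewrite subr_eq0 => /eqP D xx.
have al0 : al != 0.
  apply/eqP => al0; move: circle_radius_norm; rewrite al0 mul0r => /esym/eqP;
    rewrite expf_eq0 /= subr_eq0 => /eqP r1.
  move/eqP: xx; apply.
  have xl : x = aspect * kap x by apply/eqP; rewrite -subr_eq0 -/(circle_radius x) al0.
  have -> : x = l0^* by rewrite xl kapE mulrA -r1 mul1r.
  by rewrite conjcK mulrC.
have alc0 : al^* != 0 by rewrite conjc_eq0.
exists (h / (2 * al)).
have -> : (h / (2 * al))^* = h^* / (2 * al^*) by rewrite !(conjcM, conjc_inv, conjc_nat).
have -> : (l0 - circle_center x) * (h^* / (2 * al^*)) = (l0 -
  circle_center x) * h^* / (2 * al^*) by ring.
rewrite -D; field; exact/andP.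
Qed.

(** A solution at l0 would be an isogonal conjugate of the point x of the
    circumcircle, and x would be a vertex. *)
Lemma vertex_defect_neq0 z1 z2 z3 : family_triangle f g l0 z1 z2 z3 -> x * x^* != 1 ->
  vertex_defect != 0.
Proof.
move=> T xx; apply/eqP => D; have [d hd] := tangent_solution D xx.
pose k := (polar_const f g x - kap x * d - (kap x)^* * d^*) / w.
have sys : isogonal_system u v f g l0 x d k by apply/isogonal_system_solve.
have kc : k^* = k.
  rewrite /k conjcM conjc_inv weight_conj; congr (_ / _).
  have := polar_const_conj x; move: (polar_const f g x) (kap x) => p K pc.
  by rewrite !(conjcB, conjcM, conjcK, pc); ring.
pose y := d - x + (f + g).
have dE : d = x + y - (f + g) by rewrite /y; ring.
rewrite dE in sys; have [s1 s2 s3] := (isogonal_systemP uc vc x y kc T).2 sys.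
have [[h1 h2 h3] _ _ _] := T.
by move/eqP: xx; case: (concyclic_isogonal_vertex uc vc uv2 T s1 s2 s3 pow_tangent) => ->.
Qed.

Lemma locus_rhs_neq0 : vertex_defect != 0 -> h != 0.
Proof. by apply: contra_neq => h0; rewrite /vertex_defect h0 conjc0 !mulr0 subrr. Qed.

(** The vanishing is a computation from the equation of the vertex x.  If h were
    zero, x would be a focus of the inner ellipse (d = 0 would solve the
    system); a side through x gives k = 0 for the product of the distances to
    the tangents, and then focal_product x = 0, although the foci are inside
    the unit disk. *)
Lemma vertex_defect_eq0 z2 z3 : family_triangle f g l0 x z2 z3 -> vertex_defect = 0 /\ h != 0.
Proof.
move=> T; have e := vertex_focal_product T; have [[xx _ _] _ _ _] := T.
have kE := focal_polar_unit f g xx; have g0 := foci_off xx.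
have x0 := unit_neq0 xx.
set G := focal_product f g x in e kE g0 *.
have eq1 : x^* * G = l0 * G^*.
  transitivity ((x * x^*) * (l0 * G^*)); last by rewrite xx mul1r.
  by rewrite {1}e; ring.
have pc : polar_const f g x = - (G * G^*).
  rewrite /polar_const xx kE (conjcM (- x)) (conjcN x) conjcK.
  by transitivity (- ((x * x^*) * (G * G^*))); [ring|rewrite xx mul1r].
have hE : h = G * (1 + aspect * G^*) by rewrite /locus_rhs -/G pc; ring.
have alE : al = x * (1 + aspect * G^*) by rewrite /circle_radius kE; ring.
have lsE : l0 - circle_center x = l0 * (1 + aspect * G^*).
  rewrite /circle_center kE (conjcM (- x)) (conjcN x) conjcK.
  by transitivity (l0 + aspect * (x^* * G)); [ring|rewrite eq1; ring].
split.
  have hcE : h^* = G^* * (1 + aspect * G).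
    by rewrite hE (conjcM G) (conjcD 1) conjc1 (conjcM aspect) aspect_conj conjcK.
  have alcE : al^* = x^* * (1 + aspect * G).
    by rewrite alE (conjcM x) (conjcD 1) conjc1 (conjcM aspect) aspect_conj conjcK.
  rewrite /vertex_defect alcE lsE hcE hE.
  have -> : x^* * (1 + aspect * G) * (G * (1 + aspect * G^*)) = (x^* * G) * ((1 +
    aspect * G) * (1 + aspect * G^*)) by ring.
  by rewrite eq1; ring.
apply/eqP => h0.
pose k := polar_const f g x / w.
have sys : isogonal_system u v f g l0 x 0 k.
  by apply/isogonal_system_solve; rewrite conjc0 !mulr0 addr0 !subr0 h0.
have kc : k^* = k by rewrite /k conjcM conjc_inv polar_const_conj weight_conj.
have dE : 0 = x + (f + g - x) - (f + g) by ring.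
rewrite dE in sys; have [s1 _ _] := (isogonal_systemP uc vc x (f + g - x) kc T).2 sys.
move: s1; rewrite /side_equation.
have -> : chord_form x (x * z2) (x + z2) = 0.
  by rewrite /chord_form mulrAC xx; ring.
have [[_ h2 _] _ _ _] := T.
have pp : (x * z2) * (x * z2)^* = 1 by rewrite conjcM mulrACA xx h2 mulr1.
rewrite mul0r => /esym/eqP; rewrite mulf_eq0 (negbTE (axis_coef_neq0 uc vc uv2 pp)) orbF.
rewrite /k pc mulf_eq0 invr_eq0 (negbTE weight0) orbF oppr_eq0 mulf_eq0 conjc_eq0 orbb.
by rewrite (negbTE g0).
Qed.

(** The coefficients of the quadratic polynomial in T obtained from Cramer's
    rule by the substitution l = l0 (T + i) / (T - i), which runs over the unit
    circle minus l0 when T runs over the real numbers. *)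
Definition param2 := - vertex_defect / (4 * r).
Definition param1 := 'i * (l0 * h^*) / (2 * r).
Definition param0 := - (vertex_defect + 2 * (l0 * h^*)) / (4 * r).

(** Cramer's rule for the equation and its conjugate. *)
Lemma isogonal_solutionP l d : l * l^* = 1 -> l != l0 ->
  al * d + (l - circle_center x) * d^* = h <->
  d = - (al^* * h - (l - circle_center x) * h^*) / (r * ((l - l0) * (l - l0)^*)).
Proof.
move=> ll nl; have r0 := aspect_q_neq0.
have n0 : (l - l0) * (l - l0)^* != 0 by rewrite mulf_neq0 ?conjc_eq0 // subr_eq0.
pose D := al * al^* - (l - circle_center x) * (l - circle_center x)^*.
have DE : D = - (r * ((l - l0) * (l - l0)^*)).
  by apply: (mulIf weight0); rewrite /D circle_power // powE //; ring.
have D0 : D != 0 by rewrite DE oppr_eq0 mulf_neq0.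
have -> : - (al^* * h - (l - circle_center x) * h^*) / (r * ((l - l0) * (l - l0)^*)) =
  (al^* * h - (l - circle_center x) * h^*) / D by rewrite DE invrN mulrN mulNr.
have Dc : D^* = D.
  by rewrite /D; move: (al) (l - circle_center x) => A B; rewrite conjcB !conjcM !conjcK; ring.
split=> [e|->].
  have ec : al^* * d^* + (l - circle_center x)^* * d =
    h^* by rewrite -e (conjcD (al * d)) (conjcM al) (conjcM (l - circle_center x)) conjcK.
  by apply: (mulIf D0); rewrite divfK // -ec -e /D; ring.
have -> : ((al^* * h - (l - circle_center x) * h^*) / D)^* = (al * h^* - (l -
  circle_center x)^* * h) / D.
  by rewrite (conjcM (_ - _)) conjc_inv Dc (conjcB (al^* * h)) (conjcM al^*) (conjcM (l -
    circle_center x)) !conjcK.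
apply: (mulIf D0); rewrite mulrDl !mulrA !divfK // mulrC /D; ring.
Qed.

Lemma locus_param d :
  (exists l, [/\ l * l^* = 1, l != l0 & al * d + (l - circle_center x) * d^* = h]) <->
  exists T : R, d = param0 + T%:C * param1 + (T ^+ 2)%:C * param2.
Proof.
have r0 := aspect_q_neq0; have ec0 := aspect_neq0; have l00 := unit_neq0 ll0.
have i2 : 'i ^+ 2 = -1 :> R[i] := sqr_i R.
have i0 : 'i != 0 :> R[i] by apply/eqP => e; move: i2; rewrite e expr0n /= => /eqP;
  rewrite eq_sym oppr_eq0 oner_eq0.
have ic : 'i^* = - 'i :> R[i] by rewrite /=; apply/eqP; rewrite eq_complex /= oppr0 !eqxx.
have Ti (T : R) : T%:C - 'i != 0 by rewrite eq_complex /= negb_and sub0r oppr_eq0 oner_eq0 orbT.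
have key (T : R) : let l := l0 * ((T%:C + 'i) / (T%:C - 'i)) in
   [/\ l * l^* = 1, l != l0 &
    - (al^* * h - (l - circle_center x) * h^*) / (r * ((l - l0) * (l - l0)^*)) =
     param0 + T%:C * param1 + (T ^+ 2)%:C * param2].
  set t := T%:C => l.
  have tc : t^* = t by rewrite conjc_real.
  have t1 := Ti T; rewrite -/t in t1.
  have t2 : t + 'i != 0 by rewrite -conjc_eq0 conjcD ic tc.
  have lc : l^* = l0^* * ((t - 'i) / (t + 'i)).
    by rewrite /l conjcM (conjcM (t + 'i)) conjc_inv (conjcD t) (conjcB t) ic tc opprK.
  have lu : l * l^* = 1.
    have -> : l * l^* = l0 * l0^* by rewrite lc /l; field; apply/andP.
    exact: ll0.
  have dl : l - l0 = l0 * (2 * 'i / (t - 'i)) by rewrite /l; field.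
  have dlc : (l - l0)^* = l0^* * (- 2 * 'i / (t + 'i)).
    by rewrite dl !(conjcM, conjc_inv, conjcB, ic, tc, conjc_nat) opprK; ring.
  split=> //.
    by rewrite -subr_eq0 dl !mulf_neq0 ?invr_eq0 ?pnatr_eq0.
  have -> : (l - l0) * (l - l0)^* = 4 / (t ^+ 2 + 1).
    have -> : (l - l0) * (l - l0)^* = (l0 * l0^*) * (- 4 * 'i ^+ 2 / (t ^+ 2 - 'i ^+ 2)).
      rewrite dlc dl; field.
      by rewrite t1 t2 /= subr_sqr mulf_neq0.
    by rewrite ll0 i2 opprK mul1r; congr (_ / _); ring.
  have t3 : t ^+ 2 + 1 != 0.
    by rewrite -[1]opprK -i2 subr_sqr mulf_neq0.
  have -> : (T ^+ 2)%:C = t ^+ 2 by rewrite rmorphXn.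
  have hl : l * (t ^+ 2 + 1) = l0 * (t ^+ 2 - 1 + 2 * 'i * t).
    rewrite -[1 in LHS]opprK -i2 /l.
    have -> : l0 * ((t + 'i) / (t - 'i)) * (t ^+ 2 - 'i ^+ 2) = l0 * (t ^+ 2 + 'i ^+ 2 +
      2 * 'i * t).
      by field.
    by rewrite i2.
  have -> : - (al^* * h - (l - circle_center x) * h^*) / (r * (4 / (t ^+ 2 + 1))) =
    - ((al^* * h + circle_center x * h^*) * (t ^+ 2 + 1) - l * (t ^+ 2 + 1) * h^*) / (4 * r).
    by field; rewrite ?ec0 ?q0 ?t3.
  rewrite hl /param0 /param1 /param2 /vertex_defect; by field; rewrite ec0 q0.
split=> [[l [ll nl /(isogonal_solutionP d ll nl) ->]]|[T ->]].
  (* T is the inverse Cayley transform of l / l0 *)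
  pose m := l / l0.
  have mm : m * m^* = 1.
    by rewrite /m conjcM conjc_inv mulrACA ll -invfM ll0 invr1 mulr1.
  have m1 : m - 1 != 0 by rewrite subr_eq0 /m -(divff l00) (inj_eq (mulIf _)) ?invr_eq0.
  have mc := unit_conj mm; have m0 := unit_neq0 mm.
  pose t := 'i * (m + 1) / (m - 1).
  have e1 : m^-1 + 1 = (m + 1) / m by field.
  have e2 : m^-1 - 1 = - (m - 1) / m by field.
  have tc : t^* = t.
    rewrite /t conjcM (conjcM 'i) conjc_inv (conjcD m) (conjcB m) conjc1 ic mc e1 e2.
    by field; rewrite ?m0 ?m1.
  have [T tT] : exists T : R, t = T%:C.
    by exists (complex.Re t); move: tc; case: (t) => a b [/= h0]; congr (_ +i* _); lra.
  have lE : l = l0 * ((T%:C + 'i) / (T%:C - 'i)).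
    rewrite -tT /t.
    have -> : 'i * (m + 1) / (m - 1) + 'i = 2 * 'i * m / (m - 1) by field.
    have -> : 'i * (m + 1) / (m - 1) - 'i = 2 * 'i / (m - 1) by field.
    have -> : 2 * 'i * m / (m - 1) / (2 * 'i / (m - 1)) = m.
      by move: (m) m1 => m' m1'; field; rewrite i0 m1'.
    by rewrite /m mulrCA divff // mulr1.
  by exists T; have [_ _] := key T; rewrite -lE.
have [lu nl e] := key T; eexists; split; [exact: lu|exact: nl|].
by apply/(isogonal_solutionP _ lu nl); rewrite e.
Qed.

(** The determinant of the two coefficients is, up to a nonzero factor, the real
    part of vertex_defect times the conjugate of l0 h', and the modulus of
    circle_radius known at l0 puts us in the case of isometric_real_part. *)
Lemma param_independent : vertex_defect != 0 -> param1^* * param2 != param1 * param2^*.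
Proof.
move=> D0; have h0 := locus_rhs_neq0 D0; have r0 := aspect_q_neq0.
have l00 := unit_neq0 ll0.
have ic : 'i^* = - 'i :> R[i] by rewrite /=; apply/eqP; rewrite eq_complex /= oppr0 !eqxx.
have i0 : 'i != 0 :> R[i] by rewrite eq_complex /= negb_and oner_eq0 orbT.
set G := l0 * h^*.
have G0 : G != 0 by rewrite mulf_neq0 // conjc_eq0.
have Gc0 : G^* != 0 by rewrite conjc_eq0.
have c1 : param1^* = - 'i * G^* / (2 * r).
  by rewrite /param1 -/G (conjcM ('i * G)) (conjcM 'i G) conjc_inv (conjcM 2 r) conjc_nat ic
    aspect_q_conj.
have c2 : param2^* = - vertex_defect^* / (4 * r).
  by rewrite /param2 (conjcM (- vertex_defect)) conjcN conjc_inv (conjcM 4 r) conjc_nat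
    aspect_q_conj.
rewrite c1 c2 /param1 /param2 -/G -subr_eq0.
have -> : - 'i * G^* / (2 * r) * (- vertex_defect / (4 * r)) -
   'i * G / (2 * r) * (- vertex_defect^* / (4 * r)) =
   'i / (8 * r ^+ 2) * (G^* * vertex_defect + G * vertex_defect^*) by field;
     rewrite aspect_neq0 q0.
have c0 : 'i / (8 * r ^+ 2) != 0.
  by rewrite mulf_neq0 // invr_eq0 mulf_neq0 ?pnatr_eq0 // expf_neq0.
apply: mulf_neq0 => //.
apply/eqP => e; move/eqP: D0; apply.
apply: (isometric_real_part aspect_q_conj circle_radius_norm _ _ G0 e).
  by rewrite /G (conjcM l0) conjcK mulrACA ll0 mul1r mulrC.
by rewrite /vertex_defect circle_centerE /G mulrA; congr (_ - _); ring.
Qed.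

Lemma param1_neq0 : h != 0 -> param1 != 0.
Proof.
move=> h0; have i0 : 'i != 0 :> R[i] by rewrite eq_complex /= negb_and oner_eq0 orbT.
have G0 : l0 * h^* != 0 by rewrite mulf_neq0 ?conjc_eq0 // (unit_neq0 ll0).
have d0 : 2 * r != 0 by rewrite mulf_neq0 ?pnatr_eq0 // aspect_q_neq0.
by rewrite /param1 mulf_neq0 ?invr_eq0 // mulf_neq0.
Qed.

End Tangent.
End Locus.

(** * The swept region *)

Section ComplexContinuity.
Variables (R : realType).

Definition complex_continuous (F : R * R -> R[i]) : Prop :=
  continuous (fun P => complex.Re (F P)) /\ continuous (fun P => complex.Im (F P)).

Lemma complex_continuous_cst z : complex_continuous (fun=> z).
Proof. by split=> P; exact: cvg_cst. Qed.

Lemma complex_continuousD F G : complex_continuous F -> complex_continuous G ->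
  complex_continuous (fun P => F P + G P).
Proof.
move=> [F1 F2] [G1 G2].
have E P : F P + G P = (complex.Re (F P) + complex.Re (G P)) +i* (complex.Im (F P) +
  complex.Im (G P)).
  by case: (F P) (G P) => ? ? [? ?].
split=> P; under eq_fun do rewrite E /=.
  by apply: cvgD; [exact: F1|exact: G1].
by apply: cvgD; [exact: F2|exact: G2].
Qed.

Lemma complex_continuousN F : complex_continuous F -> complex_continuous (fun P => - F P).
Proof.
move=> [F1 F2].
have E P : - F P = (- complex.Re (F P)) +i* (- complex.Im (F P)) by case: (F P).
split=> P; under eq_fun do rewrite E /=.
  by apply: cvgN; exact: F1.
by apply: cvgN; exact: F2.
Qed.

Lemma complex_continuous_conj F : complex_continuous F -> complex_continuous (fun P => (F P)^*).
Proof.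
move=> [F1 F2].
have E P : (F P)^* = (complex.Re (F P)) +i* (- complex.Im (F P)) by case: (F P).
split=> P; under eq_fun do rewrite E /=.
  exact: F1.
by apply: cvgN; exact: F2.
Qed.

Lemma complex_continuousM F G : complex_continuous F -> complex_continuous G ->
  complex_continuous (fun P => F P * G P).
Proof.
move=> [F1 F2] [G1 G2].
have E P : F P * G P = (complex.Re (F P) * complex.Re (G P) -
  complex.Im (F P) * complex.Im (G P)) +i*
   (complex.Re (F P) * complex.Im (G P) + complex.Im (F P) * complex.Re (G P)).
  by case: (F P) (G P) => ? ? [? ?].
split=> P; under eq_fun do rewrite E /=.
  by apply: cvgB; apply: cvgM; [exact: F1|exact: G1|exact: F2|exact: G2].
by apply: cvgD; apply: cvgM; [exact: F1|exact: G2|exact: F2|exact: G1].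
Qed.

Lemma complex_continuous_ecoord (a b : R) : complex_continuous (ecoord a b).
Proof.
split=> P; rewrite /ecoord /=.
  by apply: cvgM; [exact: cvg_fst|exact: cvg_cst].
by apply: cvgM; [exact: cvg_snd|exact: cvg_cst].
Qed.

End ComplexContinuity.

(** The line Re (l A) = - c meets the unit circle when |c| < |A|. *)
Lemma unit_real_part_exists (R : realType) (c A : R[i]) : c^* = c ->
  complex.Re (c ^+ 2 - A * A^*) < 0 ->
  exists l, l * l^* = 1 /\ 2 * c + (l * A + l^* * A^*) = 0.
Proof.
case: c A => c c' A [/= h0].
have {h0} -> : c' = 0 by lra.
have [n nE] : exists n : R, A * A^* = n%:C.
  by exists (complex.Re A ^+ 2 + complex.Im A ^+ 2); case: A => ? ?; complex_field.
rewrite nE expr2 /= !(mulr0, subr0) -expr2 subr_lt0 => cn.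
have A0 : A != 0.
  apply/eqP => A0; move: nE; rewrite A0 mul0r => -[n0].
  by move: cn; rewrite -n0 ltNge sqr_ge0.
pose y := Num.sqrt (n - c ^+ 2).
have yy : y ^+ 2 = n - c ^+ 2 by rewrite sqr_sqrtr // subr_ge0 ltW.
have Ac0 : A^* != 0 by rewrite conjc_eq0.
have lc : (((- c) +i* y) / A)^* = ((- c) -i* y) / A^* by rewrite conjcM conjc_inv.
exists (((- c) +i* y) / A); rewrite lc; split.
  rewrite mulrACA -invfM nE.
  have -> : ((- c) +i* y) * ((- c) -i* y) = n%:C.
    by apply/eqP; rewrite eq_complex /=; apply/andP; split; apply/eqP; [move: yy => h; lra|ring].
  by rewrite divff // -nE mulf_neq0.
rewrite !divfK //.
by apply/eqP; rewrite eq_complex /=; apply/andP; split; apply/eqP; ring.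
Qed.

Lemma unit_real_part_le (R : realType) (c A l : R[i]) : l * l^* = 1 ->
  2 * c + (l * A + l^* * A^*) = 0 -> complex.Re (c ^+ 2 - A * A^*) <= 0.
Proof.
move=> ll e.
have -> : A * A^* = (l * A) * (l * A)^* by rewrite conjcM mulrACA ll mul1r.
have {e} : 2 * c + (l * A + (l * A)^*) = 0 by rewrite conjcM.
case: (l * A) c => x y [c c'] /eqP; rewrite eq_complex /= => /andP[/eqP h1 /eqP h2].
have hc : c = - x by lra.
have hc' : c' = 0 by lra.
by have := sqr_ge0 y; rewrite hc hc' expr2 => y0; lra.
Qed.

Lemma zero_on_boundary (R : realType) (S : set (R * R)) (psi : R * R -> R) (P : R * R) :
  continuous psi -> (forall Q, psi Q < 0 -> S Q) -> (forall Q, S Q -> psi Q <= 0) ->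
  boundary S P -> psi P = 0.
Proof.
move=> cpsi neg pos [clS nintS].
apply/eqP; rewrite eq_le; apply/andP; split.
  rewrite leNgt; apply/negP => psi0.
  have [Q [SQ Q0]] := clS _ (cvgr_gt _ (cpsi P) _ psi0).
  by move: (pos _ SQ); rewrite leNgt Q0.
rewrite leNgt; apply/negP => psi0; apply: nintS.
rewrite /interior /=; apply: filterS (cvgr_lt _ (cpsi P) _ psi0) => Q; exact: neg.
Qed.

(** As |f g| < 1, the weight (s - t Re (f g))^2 + (1 - Re (f g)^2) t^2 is positive. *)
Lemma weight_neq0 (R : realType) (s t : R) (f g : R[i]) : s ^+ 2 != t ^+ 2 ->
  f * f^* < 1 -> g * g^* < 1 -> weight s%:C t%:C f g != 0.
Proof.
move=> st f1 g1.
have : (f * g) * (f * g)^* < 1.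
  by rewrite conjcM mulrACA -[1]mulr1 ltr_pM ?mulcJ_ge0.
rewrite /weight; case: (f * g) => x y; rewrite ltcE => /andP[_ /= xy].
have x1 : x ^+ 2 < 1 by have := sqr_ge0 y; rewrite !expr2; move: xy; lra.
have -> : s%:C ^+ 2 + t%:C ^+ 2 - s%:C * t%:C * ((x +i* y) + (x +i* y)^*) =
   (s ^+ 2 + t ^+ 2 - 2 * (s * t * x))%:C :> R[i] by complex_field.
rewrite -(rmorph0 (real_complex R)) (inj_eq (@complexI R)); apply/eqP => w0.
have w1 : (s - t * x) ^+ 2 + t ^+ 2 * (1 - x ^+ 2) = 0 by rewrite -[RHS]w0; ring.
have /eqP : t ^+ 2 * (1 - x ^+ 2) = 0.
  apply/eqP; rewrite eq_le; have := sqr_ge0 (s - t * x).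
  have h : 0 <= t ^+ 2 * (1 - x ^+ 2) by rewrite mulr_ge0 ?sqr_ge0 // subr_ge0 ltW.
  by rewrite h andbT; lra.
rewrite mulf_eq0 subr_eq0 (gt_eqF x1) orbF expf_eq0 /= => /eqP t0.
move: w1; rewrite t0 !expr2 !(mul0r, subr0, addr0) => /eqP; rewrite mulf_eq0 orbb => /eqP s0.
by move: st; rewrite s0 t0 eqxx.
Qed.

Section Family.
Variables (R : realType) (a b : R) (Ec : set (R * R)).
Hypotheses (a_gt0 : 0 < a) (b_gt0 : 0 < b) (noncircular : a <> b).
Local Notation E := (axis_ellipse a b).
Local Notation ec := (ecoord a b).
Local Notation ep := (epoint a b).
Local Notation u := (((a + b) / 2)%:C).
Local Notation v := (((a - b) / 2)%:C).

Let ecK := ecoordK a_gt0 b_gt0.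
Let epK := epointK a_gt0 b_gt0.

Lemma epointD z w : ep (z + w) = ep z + ep w.
Proof. by case: z w => ? ? [? ?]; rewrite /epoint /= !mulrDr. Qed.

Lemma epointZ (t : R) z : ep (t%:C * z) = t *: ep z.
Proof. by case: z => ? ?; rewrite /epoint; congr (_, _); rewrite /GRing.scale /=; ring. Qed.

Lemma cross_epoint z w : z^* * w != z * w^* -> cross (ep z) (ep w) != 0.
Proof.
apply: contra_neq; case: z w => x y [x' y']; rewrite /cross /epoint /= => e.
have {}e : x * y' - y * x' = 0.
  by apply: (mulfI (lt0r_neq0 (mulr_gt0 a_gt0 b_gt0))); rewrite mulr0 -[RHS]e; ring.
by apply/eqP; rewrite eq_complex /=; apply/andP; split; apply/eqP; lra.
Qed.

Lemma axes_conj : u^* = u /\ v^* = v. Proof. by rewrite !conjc_real. Qed.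

Lemma axes_sqr : u ^+ 2 - v ^+ 2 != 0 :> R[i].
Proof.
have -> : u ^+ 2 - v ^+ 2 = (a * b)%:C :> R[i].
  by complex_field.
by rewrite -(rmorph0 (real_complex R)) (inj_eq (@complexI R)) lt0r_neq0 // mulr_gt0.
Qed.

Lemma axes_mul : u * v != 0 :> R[i].
Proof.
have -> : u * v = ((a + b) * (a - b) / 4)%:C :> R[i] by complex_field.
rewrite -(rmorph0 (real_complex R)) (inj_eq (@complexI R)) !mulf_neq0 ?invr_neq0 ?pnatr_eq0 //.
  by rewrite lt0r_neq0 // addr_gt0.
by rewrite subr_eq0; apply/eqP.
Qed.

Lemma axes_real_sqr : ((a + b) / 2) ^+ 2 != ((a - b) / 2) ^+ 2.
Proof.
rewrite -subr_eq0 (_ : _ - _ = a * b); last by field.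
by rewrite lt0r_neq0 // mulr_gt0.
Qed.

Lemma sqr_length_ecoord (A B : R * R) : sqr_length u v (ec B - ec A) = (dot (B - A) (B - A))%:C.
Proof. by rewrite (dot_ecoord a_gt0 b_gt0). Qed.

Variables f g K : R[i].
Hypothesis K_gt0 : 0 < K.
Hypothesis tangentE : forall A B, E A -> E B -> A <> B ->
  tangent (line A B) Ec <-> tangent_chord f g K (ec A) (ec B).
Hypothesis outside : forall z : R[i], z * z^* = 1 ->
  0 < (2 - f * z^* - f^* * z) * (2 - g * z^* - g^* * z) - K.
Hypothesis porism : poncelet_porism E Ec.

Lemma poncelet_triangleP A B C :
  poncelet_triangle E Ec A B C <-> chord_triangle f g K (ec A) (ec B) (ec C).
Proof.
rewrite /poncelet_triangle /chord_triangle.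
split=> [[nc [hA hB hC] [tAB tBC tCA]]|[[zA zB zC] [dAB dBC dCA] [tAB tBC tCA]]].
  have [zA zB zC] := And3 ((axis_ellipseP a b A).1 hA) ((axis_ellipseP a b B).1 hB)
    ((axis_ellipseP a b C).1 hC).
  have [dAB dBC dCA] := (collinear_chord a_gt0 b_gt0 zA zB zC).1 nc.
  have ne X Y : ec X != ec Y -> X <> Y by move=> /eqP h e; apply: h; rewrite e.
  by split=> //; split; apply/tangentE => //; exact: ne.
have hA := (axis_ellipseP a b A).2 zA; have hB := (axis_ellipseP a b B).2 zB.
have hC := (axis_ellipseP a b C).2 zC.
have ne X Y : ec X != ec Y -> X <> Y by move=> /eqP h e; apply: h; rewrite e.
split=> //; first exact/(collinear_chord a_gt0 b_gt0 zA zB zC).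
by split; apply/tangentE => //; exact: ne.
Qed.

Lemma chord_porism z : z * z^* = 1 -> exists z2 z3, chord_triangle f g K z z2 z3.
Proof.
move=> zz; have hA : E (ep z) by apply/axis_ellipseP; rewrite epK.
have [B [C T]] := porism hA; exists (ec B), (ec C).
by have := (poncelet_triangleP _ _ _).1 T; rewrite epK.
Qed.

Lemma chord_family_triangle z1 z2 z3 : chord_triangle f g K z1 z2 z3 ->
  family_triangle f g (z1 * z2 * z3) z1 z2 z3.
Proof.
move=> T; have s := vertex_sum K_gt0 outside T.
by case: T => h d _; split.
Qed.

Lemma family_with_product l : l * l^* = 1 ->
  exists z1 z2 z3, chord_triangle f g K z1 z2 z3 /\ family_triangle f g l z1 z2 z3.
Proof.
move=> /(triangle_with_product K_gt0 outside chord_porism) [z1 [z2 [z3 [T e]]]].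
by exists z1, z2, z3; split=> //; rewrite -e; exact: chord_family_triangle.
Qed.

Lemma swept_regionP P : swept_region E Ec P <->
  exists l : R[i], l * l^* = 1 /\ circum_power u v f g (ec P) l = 0.
Proof.
have [uc vc] := axes_conj; have uv2 := axes_sqr.
split=> [[A [B [C [/poncelet_triangleP /chord_family_triangle T cc]]]]|[l [ll p0]]].
  have [_ [_ _ _ _ ll]] := family_triangle_sums T.
  exists (ec A * ec B * ec C); split=> //.
  apply/(circum_powerP uc vc _ uv2 T).
  move/circumcircleP: cc => [D [e1 e2 e3]]; exists (ec D).
  by rewrite !sqr_length_ecoord e1 e2 e3.
have [z1 [z2 [z3 [T1 T]]]] := family_with_product ll.
have [d [e1 e2 e3]] := (circum_powerP uc vc _ uv2 T).1 p0.
exists (ep z1), (ep z2), (ep z3); split.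
  by apply/poncelet_triangleP; rewrite !epK.
apply/circumcircleP; exists (ep d).
by split; apply: (@complexI R); rewrite -!sqr_length_ecoord !epK.
Qed.

(** A zero of the power exists on the unit circle when its constant term is at
    most the amplitude of its variable part.  Both squares are continuous in the
    point, so they agree on the boundary. *)
Lemma boundary_tangency P : boundary (swept_region E Ec) P ->
  mean_power u v f g (ec P) ^+ 2 =
  4 * (u * v) ^+ 2 * (focal_polar f g (ec P) * (focal_polar f g (ec P))^*).
Proof.
have [uc vc] := axes_conj.
pose A Q := 2 * (u * v) * focal_polar f g (ec Q).
(* F compares the constant term of the power with the amplitude of the rest *)
pose F Q := mean_power u v f g (ec Q) ^+ 2 - A Q * (A Q)^*.
have powA Q l : 2 * circum_power u v f g (ec Q) l =
    2 * mean_power u v f g (ec Q) + (l * A Q + l^* * (A Q)^*).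
  have -> : (A Q)^* = 2 * (u * v) * (focal_polar f g (ec Q))^*.
    by rewrite /A (conjcM (2 * (u * v))) conjcM conjc_nat conjcM uc vc.
  by rewrite circum_powerE /A; move: (focal_polar _ _ _) => k; ring.
have cF : complex_continuous F.
  have cst z := @complex_continuous_cst R z.
  have ce := complex_continuous_ecoord a b.
  have ck : complex_continuous (fun Q => focal_polar f g (ec Q)).
    exact: (complex_continuousD (complex_continuousD (cst _) (complex_continuousN
      (complex_continuousM (cst _) ce)))
      (complex_continuousN (complex_continuous_conj ce))).
  have cfp : complex_continuous (fun Q => focal_product f g (ec Q)).
    exact: (complex_continuousM (complex_continuousD ce (cst (- f))) (complex_continuousD ce
      (cst (- g)))).
  have cp : complex_continuous (fun Q => mean_power u v f g (ec Q)).
    exact: (complex_continuousD (complex_continuousM (cst _) (complex_continuousD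
      (complex_continuousM ce (complex_continuous_conj ce)) (cst (- 1))))
      (complex_continuousM (cst _) (complex_continuousD cfp (complex_continuous_conj cfp)))).
  have cA : complex_continuous A := complex_continuousM (cst _) ck.
  exact: (complex_continuousD (complex_continuousM cp cp) (complex_continuousN
    (complex_continuousM cA (complex_continuous_conj cA)))).
move=> bP; have F0 : complex.Re (F P) = 0.
  apply: (zero_on_boundary (psi := fun Q => complex.Re (F Q)) cF.1 _ _ bP) => Q.
    move=> /(unit_real_part_exists (mean_power_conj f g uc vc (ec Q))) [l [ll e]].
    apply/swept_regionP; exists l; split=> //; apply: (@mulfI _ 2); first by rewrite pnatr_eq0.
    by rewrite powA e mulr0.
  move=> /swept_regionP [l [ll e]]; apply: (@unit_real_part_le R _ _ l) => //.
  by rewrite -powA e mulr0.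
have Fc : (F P)^* = F P.
  by rewrite /F conjcB conjcX (mean_power_conj f g uc vc) (conjcM (A P)) conjcK [_ * A P]mulrC.
have {F0}Fc : F P = 0.
  by move: Fc F0; case: (F P) => x y [/= h] ->; congr (_ +i* _); lra.
apply/eqP; rewrite -subr_eq0 -Fc /F /A (conjcM (2 * (u * v))) conjcM conjc_nat conjcM uc vc.
by apply/eqP; ring.
Qed.

Section FixedPoint.
Variable P : R * R.
Local Notation x := (ec P).

(** The triangle of parameter l0 contributes nothing since P is on its
    circumcircle.  For any other l the power is nonzero, so P is not a vertex
    and each solution of the system is an isogonal conjugate. *)
Lemma isogonal_locusP l0 : (forall l, l * l^* = 1 -> circum_power u v f g x l = 0 -> l = l0) ->
  l0 * l0^* = 1 -> circum_power u v f g x l0 = 0 ->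
  forall Q, isogonal_locus E Ec P Q <->
  exists l : R[i], [/\ l * l^* = 1, l != l0 &
    circle_radius u v f g x * (x + ec Q - (f + g)) +
    (l - circle_center u v f g x) * (x + ec Q - (f + g))^* = locus_rhs u v f g x].
Proof.
move=> uniq ll0 p0 Q.
have [uc vc] := axes_conj; have uv2 := axes_sqr.
have w0 := weight_neq0 axes_real_sqr (f_in_disk K_gt0 outside) (g_in_disk K_gt0 outside).
have c0 : 4 / (a * b) ^+ 2 != 0.
  by rewrite mulf_neq0 ?invr_neq0 ?pnatr_eq0 // expf_neq0 // lt0r_neq0 // mulr_gt0.
have sideE k A B : ec A * (ec A)^* = 1 -> ec B * (ec B)^* = 1 -> ec A != ec B ->
    isogonal_side P Q k A B <-> side_equation u v x (ec Q) (4 * k / (a * b) ^+ 2)%:C (ec A) (ec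
      B).
  move=> hA hB AB; apply: (isogonal_side_chord a_gt0 b_gt0 P Q k _ hA hB).
  by move=> e; move/eqP: AB; rewrite e.
split=> [[A [B [C [PT]]]]|[l [ll nl e]]].
  have T := chord_family_triangle ((poncelet_triangleP A B C).1 PT).
  have [nc _ _] := PT.
  have [_ [_ _ _ _ ll]] := family_triangle_sums T.
  have [[hA hB hC] [dAB dBC dCA] _ _] := T.
  move=> /(isogonal_conjugateP P Q nc) [[PA PB PC] [k [s1 s2 s3]]].
  move/(sideE _ _ _ hA hB dAB): s1 => s1; move/(sideE _ _ _ hB hC dBC): s2 => s2.
  move/(sideE _ _ _ hC hA dCA): s3 => s3.
  have inj := ecoord_inj a_gt0 b_gt0.
  exists (ec A * ec B * ec C); split=> //.
    apply/eqP => el; rewrite el in T.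
    by case: (concyclic_isogonal_vertex uc vc uv2 T s1 s2 s3 p0) => /inj.
  have := (isogonal_systemP uc vc x (ec Q) (conjc_real _) T).1 (And3 s1 s2 s3).
  by move/(isogonal_system_solve w0) => [].
have [z1 [z2 [z3 [T1 T]]]] := family_with_product ll.
have px : circum_power u v f g x l != 0 by apply: contra_neq nl; exact: uniq.
have nv z : circum_power u v f g z l = 0 -> P <> ep z.
  by move=> pz Pz; move: px; rewrite Pz epK pz eqxx.
have PT : poncelet_triangle E Ec (ep z1) (ep z2) (ep z3) by apply/poncelet_triangleP;
  rewrite !epK.
exists (ep z1), (ep z2), (ep z3); split=> //.
have [nc _ _] := PT.
have T2 := family_triangle_rot T; have T3 := family_triangle_rot T2.
apply/(isogonal_conjugateP P Q nc); split.
  split; apply: nv; [exact: circum_power_vertex T|exact: circum_power_vertex T2|exact: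
    circum_power_vertex T3].
set d := x + ec Q - (f + g) in e.
pose k := (polar_const f g x - focal_polar f g x * d -
  (focal_polar f g x)^* * d^*) / weight u v f g.
have sys : isogonal_system u v f g l x d k by apply/(isogonal_system_solve w0).
have kc : k^* = k.
  rewrite /k conjcM conjc_inv (weight_conj f g uc vc); congr (_ / _).
  have := polar_const_conj f g x; move: (polar_const f g x) (focal_polar f g x) => p k' pc.
  by rewrite (conjcB (p - k' * d)) (conjcB p) (conjcM k') (conjcM k'^*) !conjcK pc; ring.
have [k' kE] : exists k' : R, k = k'%:C.
  by exists (complex.Re k); move: kc; case: (k) => s t [/= h]; congr (_ +i* _); lra.
have [s1 s2 s3] := (isogonal_systemP uc vc x (ec Q) kc T).2 sys.
have k'E : k = (4 * (k' / (4 / (a * b) ^+ 2)) / (a * b) ^+ 2)%:C.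
  by rewrite kE; congr (_ %:C); rewrite mulrAC [4 / _ * _]mulrC divfK.
rewrite k'E in s1 s2 s3.
have [[h1 h2 h3] [d12 d23 d31] _ _] := T.
exists (k' / (4 / (a * b) ^+ 2)); split; apply/sideE; rewrite !epK //.
Qed.

Lemma boundary_locus : boundary (swept_region E Ec) P ->
  (~ E P -> is_parabola (isogonal_locus E Ec P)) /\ (E P -> is_line (isogonal_locus E Ec P)).
Proof.
move=> bP; have [uc vc] := axes_conj; have uv2 := axes_sqr; have uv0 := axes_mul.
have w0 := weight_neq0 axes_real_sqr (f_in_disk K_gt0 outside) (g_in_disk K_gt0 outside).
have off (z : R[i]) : z * z^* =
  1 -> focal_product f g z != 0 := @foci_off_circle R f g K K_gt0 outside z.
have [l0 [q [ll0 qc q0 kE pE]]] := tangency uc vc w0 uv0 off (boundary_tangency bP).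
have uniq := pow_eq0 w0 uv0 q0 pE.
have p0 := pow_tangent ll0 pE.
pose c0 := param0 u v f g x l0 q; pose c1 := param1 u v f g x l0 q;
  pose c2 := param2 u v f g x l0 q.
pose e0 := ep (f + g - x + c0).
have locE : isogonal_locus E Ec P = [set Q | exists T : R, Q = e0 + T *: ep c1 + T ^+ 2 *: ep c2].
  apply/seteqP; split=> Q.
    move/(isogonal_locusP uniq ll0 p0)/(locus_param uc vc w0 uv0 ll0 q0 pE) => [T dE].
    exists T; rewrite -[LHS]ecK -!epointZ -!epointD; congr (ep _).
    have -> : ec Q = (x + ec Q - (f + g)) + (f + g - x) by ring.
    by rewrite dE -/c0 -/c1 -/c2; ring.
  move=> [T QE]; apply/(isogonal_locusP uniq ll0 p0).
  apply/(locus_param uc vc w0 uv0 ll0 q0 pE); exists T.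
  move: QE; rewrite -!epointZ -!epointD => ->; rewrite epK -/c0 -/c1 -/c2; ring.
have PE := axis_ellipseP a b P.
rewrite locE; split=> [nEP|/PE xx].
  have xx : x * x^* != 1 by apply/eqP => /PE.
  have [z1 [z2 [z3 [_ T]]]] := family_with_product ll0.
  apply: is_parabola_param; apply: cross_epoint.
  apply: (param_independent uc vc w0 uv0 ll0 qc q0 kE pE).
  exact: (vertex_defect_neq0 uc vc w0 uv2 ll0 qc kE pE T xx).
have [z2 [z3 T]] := chord_porism xx.
have T' := chord_family_triangle T.
have le := uniq _ _ (circum_power_vertex u v T').
have [_ [_ _ _ _ ll]] := family_triangle_sums T'.
rewrite le // in T'.
have [D0 h0] := vertex_defect_eq0 uc vc w0 uv2 off T'.
have -> : [set Q | exists T : R, Q = e0 + T *: ep c1 + T ^+ 2 *: ep c2] =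
   [set Q | exists T : R, Q = e0 + T *: ep c1].
  have c20 : ep c2 = 0.
    rewrite /c2 /param2 D0 oppr0 mul0r /epoint /=; by rewrite !mulr0.
  by apply/seteqP; split=> Q [t ->]; exists t; rewrite c20 scaler0 addr0.
apply: is_line_param => e.
have : c1 != 0 by exact: param1_neq0.
by move/eqP; apply; rewrite -[c1]epK e /ecoord /= !mul0r.
Qed.

End FixedPoint.
End Family.

Theorem corollary3 (R : realType) (a b : R) (Ec : set (R * R)) (P : R * R)
  (a_gt0 : 0 < a) (b_gt0 : 0 < b) (noncircular : a <> b)
  (Ec_ellipse : is_ellipse Ec) (Ec_nested : nested_in Ec a b)
  (porism : poncelet_porism (axis_ellipse a b) Ec)
  (P_boundary : boundary (swept_region (axis_ellipse a b) Ec) P) :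
  (~ axis_ellipse a b P -> is_parabola (isogonal_locus (axis_ellipse a b) Ec P))
  /\ (axis_ellipse a b P -> is_line (isogonal_locus (axis_ellipse a b) Ec P)).
Proof.
have [f [g [K [K0 tE out]]]] := dual_conic_foci a_gt0 b_gt0 Ec_ellipse Ec_nested.
exact: (boundary_locus a_gt0 b_gt0 noncircular K0 tE out porism P_boundary).
Qed.
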